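(* Let $1/2<\alpha\le1$ and let $X_1,\dots,X_n$ be i.i.d. with probability density $f_0$ on $[0,1]$ such that $0<\rho_0\le f_0\le D_0<\infty$ for some constants $\rho_0,D_0$, and $f_0\in\mathcal C^\alpha[0,1]$. Let $h_n=(n/\log n)^{-1/(2\alpha+1)}$, $L=L_n=\lfloor\log_2(1/h_n)\rfloor$, and let the prior $\Pi$ be the law of the random histogram $$f(x)=2^{L}\sum_{k=0}^{2^{L}-1}\omega_k\mathbf 1_{I_k^{L}}(x),$$ where $I_0^L=[0,2^{-L}]$, $I_k^L=(k2^{-L},(k+1)2^{-L}]$ for $1\le k\le2^L-1$, and $(\omega_0,\dots,\omega_{2^L-1})$ has the Dirichlet distribution $\mathcal D(\alpha_0,\dots,\alpha_{2^L-1})$ on the unit simplex, with parameters $\alpha_k=\alpha_{k,L_n}$ (allowed to depend on $n$) satisfying $c_12^{-La}\le\alpha_k\le c_2$ for all $k$ and $n$, for some fixed constants $a,c_1,c_2>0$. Then for every sequence $M_n\to\infty$, $$E_{f_0}^n\,\Pi\Big[f:\|f-f_0\|_\infty>M_n\Big(\frac{\log n}{n}\Big)^{\alpha/(2\alpha+1)}\,\Big|\,X^{(n)}\Big]\to0\quad(n\to\infty).$$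
   Context: $\mathcal C^\alpha[0,1]$ for $0<\alpha\le1$ is the space of functions $g$ with $|g(x)-g(y)|\le C|x-y|^\alpha$ for some $C$ (for $\alpha=1$: Lipschitz). The posterior is $\Pi(B\mid X^{(n)})=\int_B\prod_i f(X_i)\,d\Pi(f)/\int\prod_if(X_i)\,d\Pi(f)$, and $E^n_{f_0}$ is expectation under $X_1,\dots,X_n$ i.i.d. $f_0$. *)

(* Defs.v *)
From HB Require Import structures.
From mathcomp Require Import all_boot all_order all_algebra.
From mathcomp Require Import all_classical all_reals all_analysis.
Set Implicit Arguments. Unset Strict Implicit. Unset Printing Implicit Defensive.
Import Order.TTheory GRing.Theory Num.Theory.
Local Open Scope classical_set_scope.
Local Open Scope ring_scope.

Section Defs.
Variable R : realType.
Local Notation mu := (@lebesgue_measure R).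
Definition I01 : set R := `[0%R, 1%R]%classic.

Definition holder (alpha : R) (g : R -> R) : Prop :=
  exists C : R, forall x y : R, x \in I01 -> y \in I01 ->
    `|g x - g y| <= C * `|x - y| `^ alpha.

Definition density01 (f : R -> R) : Prop :=
  measurable_fun I01 f /\ (forall x, x \in I01 -> 0 <= f x) /\
  (\int[mu]_(x in I01) (f x)%:E = 1)%E.

Definition supnorm01 (g : R -> R) : \bar R :=
  ereal_sup [set (`|g x|)%:E | x in I01].

Definition vcons (x : R) (v : nat -> R) : nat -> R :=
  fun i => if i is j.+1 then v j else x.

(* iterated (Tonelli) integral of F over [0,1]^m w.r.t. Lebesgue measure;
   coordinates 0..m-1 of the argument are the integration variables *)
Fixpoint iint (m : nat) (F : (nat -> R) -> \bar R) : \bar R :=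
  match m with
  | 0 => F (fun _ => 0)
  | m'.+1 => (\int[mu]_(x in I01) iint m' (fun v => F (vcons x v)))%E
  end.

Definition hn (alpha : R) (n : nat) : R :=
  (n%:R / ln n%:R) `^ (- (1 / (2 * alpha + 1))).
Definition Ln (alpha : R) (n : nat) : nat :=
  Num.truncn (ln (hn alpha n)^-1 / ln 2).
Definition epsn (alpha : R) (n : nat) : R :=
  (ln n%:R / n%:R) `^ (alpha / (2 * alpha + 1)).

Definition inbin (L k : nat) (x : R) : bool :=
  if k == 0%N then (0 <= x) && (x <= (2 ^+ L)^-1)
  else (k%:R * (2 ^+ L)^-1 < x) && (x <= k.+1%:R * (2 ^+ L)^-1).

Definition hist (L : nat) (w : nat -> R) (x : R) : R :=
  2 ^+ L * \sum_(k < 2 ^ L) w k * (inbin L k x)%:R.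

(* Dirichlet D(a_0,..,a_{K-1}) on the unit simplex of R^K: the free
   coordinates are w_0..w_{K-2}, and w_{K-1} = 1 - sum of the others. *)
Definition simplex_complete (K : nat) (v : nat -> R) : nat -> R :=
  fun k => if (k < K.-1)%N then v k else 1 - \sum_(j < K.-1) v j.
Definition simplex_interior (K : nat) (v : nat -> R) : bool :=
  [forall j : 'I_K, 0 < simplex_complete K v j].
Definition dir_int (K : nat) (a : nat -> R) (g : (nat -> R) -> R) : \bar R :=
  iint K.-1 (fun v =>
    if simplex_interior K v then
      (g (simplex_complete K v) *
       \prod_(k < K) (simplex_complete K v k) `^ (a k - 1))%:E
    else 0%E).
Definition dir_expect (K : nat) (a : nat -> R) (g : (nat -> R) -> R) : R :=
  fine (dir_int K a g) / fine (dir_int K a (fun _ => 1)).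

Definition hist_posterior (L : nat) (a : nat -> R) (n : nat) (X : nat -> R)
    (B : set (R -> R)) : R :=
  dir_expect (2 ^ L) a (fun w => (hist L w \in B)%:R *
                                  \prod_(i < n) hist L w (X i)) /
  dir_expect (2 ^ L) a (fun w => \prod_(i < n) hist L w (X i)).

Definition expect_iid (f0 : R -> R) (n : nat) (G : (nat -> R) -> R) : \bar R :=
  iint n (fun X => ((\prod_(i < n) f0 (X i)) * G X)%:E).

End Defs.
Arguments I01 {R}.

(* Main.v *)
Require Import Defs.
From mathcomp Require Import all_boot all_order all_algebra.
From mathcomp Require Import all_classical all_reals all_analysis.
From mathcomp Require Import measurable_realfun ring lra.
Import Order.TTheory GRing.Theory Num.Theory.
Import numFieldNormedType.Exports.
Set Implicit Arguments. Unset Strict Implicit. Unset Printing Implicit Defensive.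
Local Open Scope classical_set_scope.
Local Open Scope ring_scope.

(** By conjugacy the posterior law of the weights is Dirichlet with parameters
    [A k = a k + N_k], where [N_k] is the number of observations in bin [k].
    Write [K = 2 ^ L] and [p_k] for the mass that [f0] gives to bin [k].  The
    choice of [L] makes [eps ^ 2 * n / K >= ln n], so Chernoff's bound with tilt
    [eps] lets [|N_k - n p_k| > (2 D + 2) eps n / K] happen with probability at
    most [2 / n ^ 2].  Outside of these events all [A k] are large, and Markov's
    inequality for the posterior moments of [w_k ^ m] and [w_k ^ - m], [m] being
    the integer part of [eps n / K], bounds the posterior probability of
    [|w_k - p_k| > (7 D + 5) eps / K] by [2 / n ^ 2].  A union bound over the
    [K <= n] bins leaves [4 / n], while the bias [|f0 - K p_k|] is of order
    [K ^ - alpha <= 2 eps].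

    The Dirichlet moments are ratios of normalizing constants, that is of products
    of beta integrals, obtained by integrating out one weight after the other. *)

Section lower_integral.
Context d (T : measurableType d) (R : realType) (mu : {measure set T -> \bar R}).
Context (D : set T).
Implicit Types f g : T -> \bar R.
Local Open Scope ereal_scope.
Import HBNNSimple.

(* The integral of a nonnegative function is a supremum over simple functions
   below it, so the facts of this section hold without measurability; this disposes of
   the indicator of the sup-norm event. *)
Lemma le_lower_integral f g :
  (forall x, D x -> 0 <= f x) -> (forall x, D x -> f x <= g x) ->
  \int[mu]_(x in D) f x <= \int[mu]_(x in D) g x.
Proof.
move=> f0 fg.
have g0 x : D x -> 0 <= g x by move=> Dx; exact: le_trans (f0 _ Dx) (fg _ Dx).
rewrite !ge0_integralE//; apply: ereal_sup_le => _ [h /= hf <-].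
exists h => //= x; apply: le_trans (hf x) _.
by apply: lee_restrict => y Dy; exact: fg.
Qed.

Lemma lower_integralZl_le f (k : R) : (0 < k)%R -> (forall x, D x -> 0 <= f x) ->
  \int[mu]_(x in D) (k%:E * f x) <= k%:E * \int[mu]_(x in D) f x.
Proof.
move=> k0 f0; rewrite !ge0_integralE//; last first.
  by move=> x Dx; rewrite mule_ge0 ?f0// lee_fin ltW.
apply: ge_ereal_sup => _ [h /= hf <-].
have kV_ge0 : (0 <= k^-1)%R by rewrite invr_ge0 ltW.
rewrite -lee_pdivrMl// -sintegralrM; apply: ereal_sup_ubound.
exists (scale_nnsfun h kV_ge0) => // x /=.
rewrite EFinM lee_pdivrMl//; apply: le_trans (hf x) _.
by rewrite /patch; case: ifP => // _; rewrite mule0.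
Qed.

Lemma lower_integralZl f (k : R) : (0 <= k)%R -> (forall x, D x -> 0 <= f x) ->
  \int[mu]_(x in D) (k%:E * f x) = k%:E * \int[mu]_(x in D) f x.
Proof.
rewrite le_eqVlt => /predU1P[<-|k0] f0.
  by rewrite mul0e; apply: integral0_eq => x _; rewrite mul0e.
apply/eqP; rewrite eq_le lower_integralZl_le//=.
rewrite -lee_pdivlMl// (le_trans _ (lower_integralZl_le _ _)) ?invr_gt0//.
  by under [leRHS]eq_integral do rewrite muleA -EFinM mulVf ?gt_eqF// mul1e.
by move=> x Dx; rewrite mule_ge0 ?f0// lee_fin ltW.
Qed.

End lower_integral.

Section iterated_integrals.
Context {R : realType}.
Local Notation mu := (@lebesgue_measure R).
Implicit Types (F G : (nat -> R) -> \bar R).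

Definition cube (m : nat) : set (nat -> R) :=
  [set v | forall i, (i < m)%N -> I01 (v i)].

Lemma cube_vcons m x v : I01 x -> cube m v -> cube m.+1 (vcons x v).
Proof. by move=> xI vI [|i]//= im; exact: vI. Qed.

Lemma measurable_I01 : measurable (@I01 R).
Proof. exact: measurable_itv. Qed.

Lemma iint_ge0 m F : (forall v, cube m v -> 0 <= F v)%E -> (0 <= iint m F)%E.
Proof.
elim: m F => [|m IH] F F0 /=; first exact: F0.
apply: integral_ge0 => x xI; apply: IH => v vI; apply: F0; exact: cube_vcons.
Qed.

Lemma eq_iint m F G : (forall v, cube m v -> F v = G v) -> iint m F = iint m G.
Proof.
elim: m F G => [|m IH] F G FG /=; first exact: FG.
apply: eq_integral => x; rewrite inE => xI; apply: IH => v vI; apply: FG.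
exact: cube_vcons.
Qed.

Lemma le_iint m F G : (forall v, cube m v -> 0 <= F v)%E ->
  (forall v, cube m v -> F v <= G v)%E -> (iint m F <= iint m G)%E.
Proof.
elim: m F G => [|m IH] F G F0 FG /=; first exact: FG.
apply: le_lower_integral => x xI.
  by apply: iint_ge0 => v vI; apply: F0; exact: cube_vcons.
by apply: IH => v vI; [apply: F0|apply: FG]; exact: cube_vcons.
Qed.

Lemma iintZl m (k : R) F : 0 <= k -> (forall v, cube m v -> 0 <= F v)%E ->
  iint m (fun v => k%:E * F v)%E = (k%:E * iint m F)%E.
Proof.
move=> k0; elim: m F => [//|m IH] F F0 /=.
rewrite -lower_integralZl//; last first.
  by move=> x xI; apply: iint_ge0 => v vI; apply: F0; exact: cube_vcons.
apply: eq_integral => x; rewrite inE => xI; apply: IH => v vI; apply: F0.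
exact: cube_vcons.
Qed.

(* Among nonnegative integrands [iint] is always monotone and homogeneous, but
   additive only on these. *)
Fixpoint iint_measurable (m : nat) F : Prop :=
  if m is m'.+1 then
    (forall x, I01 x -> iint_measurable m' (fun v => F (vcons x v))) /\
    @measurable_fun _ _ (measurableTypeR R) (\bar R) I01
      (fun x => iint m' (fun v => F (vcons x v)))
  else True.

Lemma iint_measurableZl m (k : R) F : 0 <= k ->
  (forall v, cube m v -> 0 <= F v)%E ->
  iint_measurable m F -> iint_measurable m (fun v => k%:E * F v)%E.
Proof.
move=> k0; elim: m F => [//|m IH] F F0 /= [mF mI].
have Fx0 x : I01 x -> forall v, cube m v -> (0 <= F (vcons x v))%E.
  by move=> xI v vI; apply: F0; exact: cube_vcons.
split; first by move=> x xI; apply: IH; [exact: Fx0|exact: mF].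
apply: (eq_measurable_fun (fun x => k%:E * iint m (fun v => F (vcons x v)))%E).
  by move=> x; rewrite inE => xI; rewrite iintZl//; exact: Fx0.
exact: measurable_funeM.
Qed.

Lemma iint_sum m (I : finType) (F : I -> (nat -> R) -> \bar R) :
  (forall j v, cube m v -> 0 <= F j v)%E ->
  (forall j, iint_measurable m (F j)) ->
  iint m (fun v => \sum_j F j v)%E = (\sum_j iint m (F j))%E.
Proof.
elim: m F => [//|m IH] F F0 mF /=.
have Fx0 j x : I01 x -> forall v, cube m v -> (0 <= F j (vcons x v))%E.
  by move=> xI v vI; apply: F0; exact: cube_vcons.
rewrite -ge0_integral_sum//.
- apply: eq_integral => x; rewrite inE => xI; apply: IH => j; first exact: Fx0.
  by have [mFx _] := mF j; exact: mFx.
- exact: measurable_I01.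
- by move=> j; have [] := mF j.
- by move=> j x xI; apply: iint_ge0; exact: Fx0.
Qed.

Lemma le_iint_lincomb m (I : finType) (F : (nat -> R) -> \bar R) (c : I -> R)
    (G : I -> (nat -> R) -> \bar R) :
  (forall j, 0 <= c j) -> (forall j v, cube m v -> 0 <= G j v)%E ->
  (forall j, iint_measurable m (G j)) ->
  (forall v, cube m v -> 0 <= F v <= \sum_j (c j)%:E * G j v)%E ->
  (iint m F <= \sum_j (c j)%:E * iint m (G j))%E.
Proof.
move=> c0 G0 mG FG.
have cG0 j v : cube m v -> (0 <= (c j)%:E * G j v)%E.
  by move=> vI; rewrite mule_ge0 ?G0 ?lee_fin.
apply: (@le_trans _ _ (iint m (fun v => \sum_j (c j)%:E * G j v)%E)).
  by apply: le_iint => v /FG/andP[].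
rewrite iint_sum//; last by move=> j; apply: iint_measurableZl => //; exact: G0.
by apply: lee_sum => j _; rewrite iintZl//; exact: G0.
Qed.

(* The domain of [mu] and [R] carry convertible sigma-algebras under different
   displays, which unification does not see through. *)
Lemma measurable_EFin (f : R -> R) (D : set R) : measurable_fun D f ->
  @measurable_fun _ _ (measurableTypeR R) (\bar R) D (fun x => (f x)%:E).
Proof. by move=> mf; have /measurable_EFinP := mf. Qed.

Lemma iintS m F (s : R -> R) : measurable_fun I01 s ->
  (forall x, I01 x -> iint_measurable m (fun v => F (vcons x v)) /\
                      iint m (fun v => F (vcons x v)) = (s x)%:E) ->
  iint_measurable m.+1 F /\ iint m.+1 F = (\int[mu]_(x in I01) (s x)%:E)%E.
Proof.
move=> ms Fs; split=> /=; last first.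
  by apply: eq_integral => x; rewrite inE => /Fs[].
split; first by move=> x /Fs[].
apply: (eq_measurable_fun (fun x => (s x)%:E)); last exact: measurable_EFin.
by move=> x; rewrite inE => /Fs[].
Qed.

Lemma iint_prod n (f : R -> R) (t : R) : measurable_fun I01 f ->
  (forall x, I01 x -> 0 <= f x) ->
  (\int[mu]_(x in I01) (f x)%:E = t%:E)%E ->
  iint_measurable n (fun X => (\prod_(i < n) f (X i))%:E) /\
  iint n (fun X => (\prod_(i < n) f (X i))%:E) = (t ^+ n)%:E.
Proof.
move=> mf f0 ft; elim: n => [|n [IHm IHt]]; first by rewrite /= big_ord0 expr0.
have prod0 v : cube n v -> (0 <= (\prod_(i < n) f (v i))%:E)%E.
  by move=> vI; rewrite lee_fin prodr_ge0// => i _; apply: f0; exact: vI.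
have [||mprod ->] := @iintS n (fun X => (\prod_(i < n.+1) f (X i))%:E)
  (fun x => t ^+ n * f x).
- exact: measurable_funM.
- move=> x xI.
  have -> : (fun v => (\prod_(i < n.+1) f (vcons x v i))%:E) =
      (fun v => (f x)%:E * (\prod_(i < n) f (v i))%:E)%E.
    by apply/funext => v; rewrite big_ord_recl EFinM.
  split; first by apply: iint_measurableZl => //; exact: f0.
  by rewrite iintZl ?f0// IHt -EFinM mulrC.
- have t0 : 0 <= t.
    by rewrite -lee_fin -ft; apply: integral_ge0 => x xI; rewrite lee_fin f0.
  split=> //; under eq_integral do rewrite EFinM.
  by rewrite lower_integralZl ?exprn_ge0// ?ft -?EFinM ?exprSr//.
Qed.

End iterated_integrals.

Section beta_integrals.
Context {R : realType}.
Local Notation mu := (@lebesgue_measure R).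
Implicit Types a b c r y : R.

(* [powR] is constantly 1 on negative numbers, so it has to be truncated there
   to be continuous at 0. *)
Definition pospow (c : R) (y : R) : R := (Num.max y 0) `^ c.

Lemma pospowE c y : 0 <= y -> pospow c y = y `^ c.
Proof. by move=> y0; rewrite /pospow max_l. Qed.

Lemma pospow_eq0 c y : 0 < c -> y <= 0 -> pospow c y = 0.
Proof. by move=> c0 y0; rewrite /pospow max_r// powR0// gt_eqF. Qed.

Lemma pospow_ge0 c y : 0 <= pospow c y.
Proof. exact: powR_ge0. Qed.

Lemma pospowD1 c y : 0 < c -> pospow (c + 1) y = pospow c y * y.
Proof.
move=> c0; have c1 : 0 < c + 1 by rewrite addr_gt0.
have [y0|/ltW y0] := leP 0 y; last by rewrite !pospow_eq0 ?mul0r.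
by rewrite !pospowE// -(mulr_powRB1 y0 c1) addrK mulrC.
Qed.

Lemma is_derive_pospow c y : 0 < y ->
  is_derive y 1 (pospow c) (c * pospow (c - 1) y).
Proof.
move=> y0; rewrite pospowE ?ltW//.
apply: (near_eq_is_derive _ (is_derive1_powR c y0)).
near=> z; rewrite pospowE//.
by apply: ltW; near: z; exact: lt_nbhsr.
Unshelve. all: by end_near. Qed.

Lemma continuous_pospow c : 0 < c -> continuous (pospow c).
Proof.
move=> c0 x; have [x0|x0|x0] := ltgtP x 0.
- have : (cst 0 : R -> R) @ x --> (0 : R) by exact: cvg_cst.
  rewrite /continuous_at pospow_eq0 ?ltW//.
  apply: cvg_trans; apply: near_eq_cvg.
  near=> y; rewrite pospow_eq0//.
  by apply: ltW; near: y; exact: lt_nbhsl.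
- have [D _] := is_derive_pospow c x0.
  exact: differentiable_continuous ((derivable1_diffP _ _).1 D).
- rewrite x0 /continuous_at (pospow_eq0 c0)//.
  apply/cvgrPdist_lt => e e0; near=> y.
  rewrite sub0r normrN.
  have [y0|y0] := leP y 0; first by rewrite pospow_eq0// normr0.
  rewrite pospowE ?ltW// ger0_norm ?powR_ge0//.
  have -> : e = (e `^ c^-1) `^ c by rewrite -powRrM mulVf ?gt_eqF// powRr1// ltW.
  rewrite gt0_ltr_powR ?nnegrE ?powR_ge0 ?ltW//.
  rewrite (le_lt_trans (ler_norm _))//.
  near: y; exists (e `^ c^-1); first exact: powR_gt0.
  by move=> z /=; rewrite sub0r normrN.
Unshelve. all: by end_near. Qed.

Definition beta_kernel (a b r y : R) : R :=
  pospow (a - 1) y * pospow (b - 1) (r - y).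

Lemma beta_kernel_ge0 a b r y : 0 <= beta_kernel a b r y.
Proof. by rewrite mulr_ge0 ?pospow_ge0. Qed.

Lemma continuous_beta_kernel a b r : 1 < a -> 1 < b ->
  continuous (beta_kernel a b r).
Proof.
move=> a1 b1 y; apply: continuousM.
  by apply: continuous_pospow; rewrite subr_gt0.
apply: (@continuous_comp _ _ _ (fun y => r - y) (pospow (b - 1))).
  by apply: continuousB; [exact: cvg_cst|exact: cvg_id].
by apply: continuous_pospow; rewrite subr_gt0.
Qed.

Lemma measurable_beta_kernel a b r (D : set R) : 1 < a -> 1 < b ->
  measurable_fun D (beta_kernel a b r).
Proof.
move=> a1 b1; apply: measurable_funTS; apply: continuous_measurable_fun.
exact: continuous_beta_kernel.
Qed.

Lemma integrable_beta_kernel a b r : 1 < a -> 1 < b ->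
  mu.-integrable I01 (EFin \o beta_kernel a b r).
Proof.
move=> a1 b1; apply: continuous_compact_integrable; first exact: segment_compact.
by apply: continuous_subspaceT; exact: continuous_beta_kernel.
Qed.

Definition beta_integral (a b : R) : R :=
  (\int[mu]_(y in I01) beta_kernel a b 1 y)%R.

Lemma EFin_beta_integral a b : 1 < a -> 1 < b ->
  (beta_integral a b)%:E = (\int[mu]_(y in I01) (beta_kernel a b 1 y)%:E)%E.
Proof.
move=> a1 b1; rewrite /beta_integral /Rintegral fineK//.
apply: integrable_fin_num; first exact: measurable_I01.
exact: integrable_beta_kernel.
Qed.

Lemma integrable_beta_kernelZ c a b : 1 < a -> 1 < b ->
  mu.-integrable I01 (EFin \o (fun y => c * beta_kernel a b 1 y)).
Proof.
move=> a1 b1; apply: (@integrableZl _ _ _ mu _ _ c (EFin \o beta_kernel a b 1)).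
  exact: measurable_I01.
exact: integrable_beta_kernel.
Qed.

Lemma Rintegral_beta_kernelZ c a b : 1 < a -> 1 < b ->
  (\int[mu]_(y in I01) (c * beta_kernel a b 1 y))%R = c * beta_integral a b.
Proof.
move=> a1 b1; rewrite RintegralZl//; first exact: measurable_I01.
exact: integrable_beta_kernel.
Qed.

Lemma beta_integral_gt0 a b : 1 < a -> 1 < b -> 0 < beta_integral a b.
Proof.
move=> a1 b1; pose middle : set R := `[4^-1, 3 / 4]%classic.
pose lower : R := 4^-1 `^ (a - 1) * 4^-1 `^ (b - 1).
have lower_gt0 : 0 < lower by rewrite mulr_gt0 ?powR_gt0.
have middle_lt : 4^-1 < 3 / 4 :> R by lra.
have mu_middle : mu middle = (3 / 4 - 4^-1)%:E.
  by rewrite lebesgue_measure_itv/= lte_fin middle_lt.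
rewrite -lte_fin EFin_beta_integral//.
apply: (@lt_le_trans _ _ (\int[mu]_(y in middle) lower%:E)%E).
  rewrite integral_cst; last exact: measurable_itv.
  by rewrite [X in (_ * X)%E]mu_middle -EFinM lte_fin mulr_gt0 ?subr_gt0.
apply: (@le_trans _ _ (\int[mu]_(y in middle) (beta_kernel a b 1 y)%:E)%E).
  apply: le_lower_integral => y; first by rewrite lee_fin ltW.
  rewrite /middle/= in_itv/= => /andP[y1 y2]; rewrite lee_fin /beta_kernel.
  have [y_ge0 oney_ge0] : 0 <= y /\ 0 <= 1 - y by split; lra.
  have [am1_ge0 bm1_ge0] : 0 <= a - 1 /\ 0 <= b - 1 by split; lra.
  rewrite !pospowE// ler_pM ?powR_ge0// ge0_ler_powR ?nnegrE ?invr_ge0//; lra.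
apply: ge0_subset_integral => //.
- exact: measurable_itv.
- exact: measurable_I01.
- by apply: measurable_EFin; exact: measurable_beta_kernel.
- by move=> y _; rewrite lee_fin beta_kernel_ge0.
- move=> y; rewrite /middle /I01/= !in_itv/= => /andP[y1 y2].
  by apply/andP; split; lra.
Qed.

Lemma integral_beta_kernel_itv a b r : 1 < a -> 1 < b -> r <= 1 ->
  (\int[mu]_(y in I01) (beta_kernel a b r y)%:E =
   \int[mu]_(y in `[0%R, r]) (beta_kernel a b r y)%:E)%E.
Proof.
move=> a1 b1 r1; rewrite integral_mkcond [RHS]integral_mkcond; congr integral.
apply/funext => y; rewrite /patch/= /I01 !mem_setE !in_itv/=.
have [y0|//] := leP 0 y; have [yr|yr]/= := leP y r.
  by rewrite (le_trans yr r1).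
by case: ifP => // _; rewrite /beta_kernel [X in _ * X]pospow_eq0 ?mulr0//; lra.
Qed.

Lemma beta_kernel_scale a b r u : 0 < r -> 0 <= u <= 1 ->
  beta_kernel a b r (r * u) * r = r `^ (a + b - 1) * beta_kernel a b 1 u.
Proof.
move=> r0 /andP[u0 u1]; rewrite /beta_kernel.
have oneu_ge0 : 0 <= 1 - u by rewrite subr_ge0.
have -> : r - r * u = r * (1 - u) by ring.
rewrite !pospowE ?mulr_ge0 ?(ltW r0)// !powRM ?(ltW r0)//.
have -> : r `^ (a + b - 1) = r `^ (a - 1) * r `^ (b - 1) * r.
  rewrite -[X in _ * X]powRr1 ?(ltW r0)// -!powRD ?(gt_eqF r0) ?implybT//.
  by congr powR; ring.
by ring.
Qed.

Lemma integral_beta_kernel a b r : 1 < a -> 1 < b -> r <= 1 ->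
  (\int[mu]_(y in I01) (beta_kernel a b r y)%:E =
   (pospow (a + b - 1) r * beta_integral a b)%:E)%E.
Proof.
move=> a1 b1 r1; have [r0|r0] := leP r 0.
  rewrite pospow_eq0//; last by lra.
  rewrite mul0r; apply: integral0_eq => y; rewrite /I01/= in_itv/= => /andP[y0 _].
  by rewrite /beta_kernel [X in _ * X]pospow_eq0 ?mulr0//; lra.
have dscale : derive1 (fun u : R => r * u) = cst r.
  by apply/funext => u; rewrite derive1E derive_val ?scaler1//; exact: mulr1.
have cscale : continuous (fun u : R => r * u) by exact: mulrl_continuous.
rewrite integral_beta_kernel_itv//.
have -> : `[0, r]%classic = `[r * 0, r * 1]%classic by rewrite mulr0 mulr1.
rewrite (@integration_by_substitution_increasing _ (fun u => r * u))//.
- rewrite dscale pospowE ?ltW// EFinM EFin_beta_integral//.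
  rewrite -lower_integralZl ?powR_ge0//; last first.
    by move=> y _; rewrite lee_fin beta_kernel_ge0.
  apply: eq_integral => u; rewrite inE /= in_itv/= => u01.
  by rewrite -EFinM -beta_kernel_scale.
- by move=> x y _ _ xy; rewrite ltr_pM2l.
- by rewrite dscale => x _; exact: cst_continuous.
- by rewrite dscale; exact: is_cvg_cst.
- by rewrite dscale; exact: is_cvg_cst.
- split; first by move=> x _; exact: ex_derive.
    by apply: cvg_at_right_filter; exact: cscale.
  by apply: cvg_at_left_filter; exact: cscale.
- by apply: continuous_subspaceT; exact: continuous_beta_kernel.
Qed.

Lemma beta_kernelDl a b r y : 1 < a ->
  beta_kernel (a + 1) b r y = y * beta_kernel a b r y.
Proof.
by move=> a1; rewrite /beta_kernel addrAC pospowD1 ?subr_gt0//; ring.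
Qed.

Lemma beta_kernelDr a b r y : 1 < b ->
  beta_kernel a (b + 1) r y = (r - y) * beta_kernel a b r y.
Proof.
by move=> b1; rewrite /beta_kernel addrAC pospowD1 ?subr_gt0//; ring.
Qed.

Lemma is_derive_beta_kernel a b y : 0 < y < 1 ->
  is_derive y 1 (beta_kernel (a + 1) (b + 1) 1)
    (a * beta_kernel a (b + 1) 1 y - b * beta_kernel (a + 1) b 1 y).
Proof.
move=> /andP[y0 y1]; rewrite /beta_kernel !addrK.
have dl : is_derive y 1 (pospow a) (a * pospow (a - 1) y).
  exact: is_derive_pospow.
have dr : is_derive (1 - y) 1 (pospow b) (b * pospow (b - 1) (1 - y)).
  by apply: is_derive_pospow; rewrite subr_gt0.
have d1y : is_derive y (1 : R) (fun y : R => 1 - y) (- 1).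
  by apply: is_derive_eq; ring.
have dr_comp := @is_derive1_comp _ (pospow b) (fun y => 1 - y) y _ _ dr d1y.
apply: (is_derive_eq (is_deriveM dl dr_comp)); rewrite /GRing.scale/=.
by ring.
Qed.

Lemma beta_integral_sum a b : 1 < a -> 1 < b ->
  beta_integral (a + 1) b + beta_integral a (b + 1) = beta_integral a b.
Proof.
move=> a1 b1; rewrite /beta_integral -RintegralD; last 3 first.
- exact: measurable_I01.
- by apply: integrable_beta_kernel; lra.
- by apply: integrable_beta_kernel; lra.
by apply: eq_Rintegral => y _; rewrite beta_kernelDl// beta_kernelDr//; ring.
Qed.

Lemma beta_integral_parts a b : 1 < a -> 1 < b ->
  a * beta_integral a (b + 1) = b * beta_integral (a + 1) b.
Proof.
move=> a1 b1.
pose f y := a * beta_kernel a (b + 1) 1 y - b * beta_kernel (a + 1) b 1 y.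
have [a2 b2] : 1 < a + 1 /\ 1 < b + 1 by split; lra.
suff int_f : \int[mu]_(y in I01) f y = 0.
  move: int_f; rewrite RintegralB; last 3 first.
  - exact: measurable_I01.
  - exact: integrable_beta_kernelZ.
  - exact: integrable_beta_kernelZ.
  rewrite (Rintegral_beta_kernelZ _ a1 b2) (Rintegral_beta_kernelZ _ a2 b1).
  by move/subr0_eq.
have cF := @continuous_beta_kernel (a + 1) (b + 1) 1 a2 b2.
rewrite /Rintegral (@continuous_FTC2 _ f (beta_kernel (a + 1) (b + 1) 1) 0 1)//.
- have [a0 b0] : 0 < a /\ 0 < b by split; lra.
  rewrite /beta_kernel !addrK subrr subr0 (pospow_eq0 a0 (lexx 0)).
  rewrite (pospow_eq0 b0 (lexx 0)) mulr0 mul0r.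
  by rewrite /= subrr.
- apply: continuous_subspaceT => y.
  apply: cvgB; apply: cvgM; try exact: cvg_cst; exact: continuous_beta_kernel.
- split.
  + by move=> y; rewrite in_itv/= => /(is_derive_beta_kernel a b)[].
  + by apply: cvg_at_right_filter; exact: cF.
  + by apply: cvg_at_left_filter; exact: cF.
- move=> y; rewrite in_itv/= => /(is_derive_beta_kernel a b)[_ dF].
  by rewrite derive1E dF.
Qed.

Lemma beta_integralSl a b : 1 < a -> 1 < b ->
  beta_integral (a + 1) b = a / (a + b) * beta_integral a b.
Proof.
move=> a1 b1; have ab0 : a + b != 0 by rewrite gt_eqF//; lra.
move: (beta_integral_parts a1 b1); rewrite -(beta_integral_sum a1 b1).
move: (beta_integral (a + 1) b) (beta_integral a (b + 1)) => Bl Br parts.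
by rewrite mulrDr -[in X in _ = _ + X]mulrAC parts; field.
Qed.

Lemma beta_integralSr a b : 1 < a -> 1 < b ->
  beta_integral a (b + 1) = b / (a + b) * beta_integral a b.
Proof.
move=> a1 b1; have ab0 : a + b != 0 by rewrite gt_eqF//; lra.
move: (beta_integral_parts a1 b1); rewrite -(beta_integral_sum a1 b1).
move: (beta_integral (a + 1) b) (beta_integral a (b + 1)) => Bl Br parts.
by rewrite mulrDr -[in X in _ = X + _]mulrAC -parts; field.
Qed.

End beta_integrals.

Section dirichlet_integrals.
Context {R : realType}.
Implicit Types (b v w : nat -> R) (K k m : nat) (r x : R).

(* The unnormalized Dirichlet density on [K.+1] nonnegative weights of sum [r],
   in terms of the first [K] of them. *)
Definition dirichlet_kernel K r b v : R :=
  (\prod_(k < K) pospow (b k - 1) (v k)) *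
    pospow (b K - 1) (r - \sum_(k < K) v k).

(* Integrating out weight [i] leaves its beta integral against the total of the
   later parameters. *)
Definition dirichlet_const K b : R :=
  \prod_(i < K.-1) beta_integral (b i) (\sum_(i.+1 <= j < K) b j).

Definition tail b : nat -> R := fun k => b k.+1.

Lemma sum_tail K b : \sum_(k < K.+1) b k = b 0%N + \sum_(k < K) tail b k.
Proof. exact: big_ord_recl. Qed.

Lemma tail_gt1 K b : (forall k, (k < K.+1)%N -> 1 < b k) ->
  forall k, (k < K)%N -> 1 < tail b k.
Proof. by move=> b1 k kK; exact: b1. Qed.

Lemma dirichlet_const1 b : dirichlet_const 1 b = 1.
Proof. by rewrite /dirichlet_const big_ord0. Qed.

Lemma dirichlet_constS K b :
  dirichlet_const K.+2 b =
  beta_integral (b 0%N) (\sum_(k < K.+1) tail b k) * dirichlet_const K.+1 (tail b).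
Proof.
rewrite /dirichlet_const /= big_ord_recl big_add1 big_mkord; congr (_ * _).
by apply: eq_bigr => i _; rewrite big_add1.
Qed.

Lemma sum_gt1 K b : (forall k, (k < K.+1)%N -> 1 < b k) ->
  1 < \sum_(k < K.+1) b k.
Proof.
move=> b1; rewrite big_ord_recl ltr_wpDr ?b1// sumr_ge0// => j _.
by apply: le_trans (ltW (b1 _ (ltn_ord _))).
Qed.

Lemma dirichlet_const_gt0 K b : (forall k, (k < K)%N -> 1 < b k) ->
  0 < dirichlet_const K b.
Proof.
case: K => [|K]; first by rewrite /dirichlet_const big_ord0.
elim: K b => [|K IH] b b1; first by rewrite dirichlet_const1.
have b1S := tail_gt1 b1.
by rewrite dirichlet_constS mulr_gt0 ?IH// beta_integral_gt0 ?b1// sum_gt1.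
Qed.

Lemma dirichlet_kernel_ge0 K r b v : 0 <= dirichlet_kernel K r b v.
Proof. by rewrite mulr_ge0 ?pospow_ge0// prodr_ge0// => k _; exact: pospow_ge0. Qed.

Lemma dirichlet_kernel_vcons K r b x v :
  dirichlet_kernel K.+1 r b (vcons x v) =
  pospow (b 0%N - 1) x * dirichlet_kernel K (r - x) (tail b) v.
Proof.
by rewrite /dirichlet_kernel !big_ord_recl /= -mulrA opprD addrA.
Qed.

Lemma iint_dirichlet_kernel K r b : r <= 1 ->
  (forall k, (k < K.+1)%N -> 1 < b k) ->
  iint_measurable K (fun v => (dirichlet_kernel K r b v)%:E) /\
  iint K (fun v => (dirichlet_kernel K r b v)%:E) =
    (pospow (\sum_(k < K.+1) b k - 1) r * dirichlet_const K.+1 b)%:E.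
Proof.
elim: K r b => [|K IH] r b r1 b1.
  split=> //=; rewrite /dirichlet_kernel dirichlet_const1 big_ord1 !big_ord0.
  by rewrite mul1r mulr1 subr0.
have b1S := tail_gt1 b1.
pose tail_sum := \sum_(k < K.+1) tail b k.
have tail_sum1 : 1 < tail_sum by exact: sum_gt1 b1S.
pose Z := dirichlet_const K.+1 (tail b).
have [||mk ->] := @iintS _ K (fun v => (dirichlet_kernel K.+1 r b v)%:E)
  (fun x => Z * beta_kernel (b 0%N) tail_sum r x).
- apply: measurable_funM; first exact: measurable_cst.
  by apply: measurable_beta_kernel; rewrite ?b1.
- move=> x; rewrite /I01/= in_itv/= => /andP[x0 _].
  have rx1 : r - x <= 1 by lra.
  have [mtail tailE] := IH _ _ rx1 b1S.
  have tail0 v : cube K v ->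
      (0 <= (dirichlet_kernel K (r - x) (tail b) v)%:E)%E.
    by move=> _; rewrite lee_fin dirichlet_kernel_ge0.
  have -> : (fun v => (dirichlet_kernel K.+1 r b (vcons x v))%:E) =
      (fun v => (pospow (b 0%N - 1) x)%:E *
        (dirichlet_kernel K (r - x) (tail b) v)%:E)%E.
    by apply/funext => v; rewrite dirichlet_kernel_vcons EFinM.
  split; first by apply: iint_measurableZl => //; exact: pospow_ge0.
  rewrite iintZl ?pospow_ge0// tailE -EFinM; congr EFin.
  by rewrite /beta_kernel -/tail_sum -/Z; ring.
- split=> //; under eq_integral do rewrite EFinM.
  have [Z0 b01] : 0 <= Z /\ 1 < b 0%N by rewrite ltW ?dirichlet_const_gt0 ?b1.
  rewrite lower_integralZl//; last by move=> x _; rewrite lee_fin beta_kernel_ge0.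
  rewrite integral_beta_kernel// -EFinM dirichlet_constS (sum_tail _ b).
  by rewrite -/tail_sum -/Z; congr EFin; ring.
Qed.

Definition shift_at b k x : nat -> R := fun j => b j + x *+ (j == k).

Lemma shift_atxx b k x : shift_at b k x k = b k + x.
Proof. by rewrite /shift_at eqxx. Qed.

Lemma shift_at0 b k : shift_at b k 0 = b.
Proof. by apply/funext => j; rewrite /shift_at mul0rn addr0. Qed.

Lemma shift_atD b k x y : shift_at b k (x + y) = shift_at (shift_at b k x) k y.
Proof. by apply/funext => j; rewrite /shift_at mulrnDl addrA. Qed.

Lemma tail_shift_at0 b x : tail (shift_at b 0 x) = tail b.
Proof. by apply/funext => j; rewrite /tail /shift_at mulr0n addr0. Qed.

Lemma tail_shift_atS b k x : tail (shift_at b k.+1 x) = shift_at (tail b) k x.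
Proof. by []. Qed.

Lemma sum_shift_at K b k x : (k < K)%N ->
  \sum_(j < K) shift_at b k x j = \sum_(j < K) b j + x.
Proof.
move=> kK; rewrite big_split/=; congr (_ + _).
rewrite (bigD1 (Ordinal kK))//= eqxx mulr1n big1 ?addr0// => j jk.
by rewrite (negbTE (_ : val j != k)).
Qed.

Lemma shift_at_gt1 K b k x : (forall j, (j < K)%N -> 1 < b j) -> 1 < b k + x ->
  forall j, (j < K)%N -> 1 < shift_at b k x j.
Proof.
move=> b1 bk j jK; rewrite /shift_at; case: eqP => [->//|_].
by rewrite mulr0n addr0 b1.
Qed.

Lemma dirichlet_const_shift1 K b k : (forall j, (j < K)%N -> 1 < b j) ->
  (k < K)%N ->
  dirichlet_const K (shift_at b k 1) =
  b k / (\sum_(j < K) b j) * dirichlet_const K b.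
Proof.
case: K => // K; elim: K b k => [|K IH] b k b1 kK.
  have -> : k = 0%N by case: k kK.
  rewrite !dirichlet_const1 big_ord1 divff ?mulr1// gt_eqF//.
  by have := b1 0%N (ltnSn _); lra.
have b1S := tail_gt1 b1.
have tail1 := sum_gt1 b1S.
have b01 : 1 < b 0%N by exact: b1.
rewrite !dirichlet_constS (sum_tail _ b).
case: k kK => [|k] kK.
  by rewrite tail_shift_at0 shift_atxx beta_integralSl// mulrA.
rewrite tail_shift_atS IH// sum_shift_at//.
have -> : shift_at b k.+1 1 0 = b 0%N by rewrite /shift_at mulr0n addr0.
rewrite beta_integralSr// -[b k.+1]/(tail b k).
by field; rewrite !gt_eqF//; lra.
Qed.

Lemma dirichlet_const_shiftn K b k m : (forall j, (j < K)%N -> 1 < b j) ->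
  (k < K)%N ->
  dirichlet_const K (shift_at b k m%:R) =
  (\prod_(i < m) ((b k + i%:R) / (\sum_(j < K) b j + i%:R))) * dirichlet_const K b.
Proof.
move=> b1 kK; elim: m => [|m IH]; first by rewrite shift_at0 big_ord0 mul1r.
rewrite -[m.+1%:R]natr1 shift_atD (dirichlet_const_shift1 _ kK); last first.
  by apply: shift_at_gt1 => //; rewrite ltr_wpDr ?b1.
by rewrite IH big_ord_recr/= shift_atxx sum_shift_at// mulrCA mulrA.
Qed.

End dirichlet_integrals.

Section dirichlet_expectation.
Context {R : realType}.
Implicit Types (a b w v : nat -> R) (g h : (nat -> R) -> R) (K k m : nat).

Definition positive_weights K : set (nat -> R) :=
  [set w | forall k, (k < K)%N -> 0 < w k].

Lemma simplex_interiorP K v :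
  simplex_interior K v -> positive_weights K (simplex_complete K v).
Proof. by move=> /forallP v0 k kK; exact: (v0 (Ordinal kK)). Qed.

Definition dir_integrand K a g v : \bar R :=
  if simplex_interior K v then
    (g (simplex_complete K v) *
     \prod_(k < K) (simplex_complete K v k) `^ (a k - 1))%:E
  else 0%E.

Lemma dir_intE K a g : dir_int K a g = iint K.-1 (dir_integrand K a g).
Proof. by []. Qed.

Lemma dir_integrand_ge0 K a g v : (forall w, positive_weights K w -> 0 <= g w) ->
  (0 <= dir_integrand K a g v)%E.
Proof.
move=> g0; rewrite /dir_integrand; case: ifPn => // /simplex_interiorP/g0 gv0.
by rewrite lee_fin mulr_ge0// prodr_ge0// => k _; exact: powR_ge0.
Qed.

Lemma le_dir_integrand K a g h v : (forall w, positive_weights K w -> g w <= h w) ->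
  (dir_integrand K a g v <= dir_integrand K a h v)%E.
Proof.
move=> gh; rewrite /dir_integrand; case: ifPn => // /simplex_interiorP/gh ghv.
by rewrite lee_fin ler_wpM2r// prodr_ge0// => k _; exact: powR_ge0.
Qed.

Lemma dir_integrand_prod_powR K a (x : nat -> R) g v :
  dir_integrand K a (fun w => g w * \prod_(k < K) w k `^ x k) v =
  dir_integrand K (fun k => a k + x k) g v.
Proof.
rewrite /dir_integrand; case: ifPn => // /simplex_interiorP v0.
rewrite -mulrA -big_split/=; congr ((_ * _)%:E); apply: eq_bigr => k _.
rewrite -powRD; last by rewrite (gt_eqF (v0 _ _)) ?implybT.
by congr powR; ring.
Qed.

Lemma dir_integrand_powR K a k (x : R) v : (k < K)%N ->
  dir_integrand K a (fun w => w k `^ x) v =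
  dir_integrand K (shift_at a k x) (fun=> 1) v.
Proof.
move=> kK; rewrite -[RHS](dir_integrand_prod_powR K a (fun j => x *+ (j == k))).
congr dir_integrand; apply/funext => w; rewrite mul1r (bigD1 (Ordinal kK))//=.
rewrite eqxx mulr1n big1 ?mulr1// => j jk.
by rewrite (negbTE (_ : val j != k)) ?mulr0n ?powRr0.
Qed.

Lemma dir_integrand_lincomb K a (I : finType) (c : I -> R)
    (g : I -> (nat -> R) -> R) v :
  dir_integrand K a (fun w => \sum_j c j * g j w) v =
  (\sum_j (c j)%:E * dir_integrand K a (g j) v)%E.
Proof.
rewrite /dir_integrand; case: ifP => _; last by rewrite big1// => j _; rewrite mule0.
rewrite mulr_suml -sumEFin; apply: eq_bigr => j _.
by rewrite -EFinM mulrA.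
Qed.

Lemma dir_integrand1 K b : (0 < K)%N -> (forall k, (k < K)%N -> 1 < b k) ->
  dir_integrand K b (fun=> 1) = (fun v => (dirichlet_kernel K.-1 1 b v)%:E).
Proof.
case: K => // K _ b1; apply/funext => v.
have -> : dirichlet_kernel K 1 b v =
    \prod_(k < K.+1) pospow (b k - 1) (simplex_complete K.+1 v k).
  rewrite big_ord_recr/= /simplex_complete/= ltnn; congr (_ * _).
  by apply: eq_bigr => k _; rewrite ltn_ord.
rewrite /dir_integrand mul1r; case: ifPn => [/simplex_interiorP v0|/forallPn[k]].
  by congr EFin; apply: eq_bigr => k _; rewrite pospowE// ltW// v0.
rewrite -leNgt => vk; rewrite (bigD1 k)//= pospow_eq0 ?mul0r//.
by rewrite subr_gt0 b1.
Qed.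

Lemma dir_int_ge0 K a g : (forall w, positive_weights K w -> 0 <= g w) ->
  (0 <= dir_int K a g)%E.
Proof. by move=> g0; apply: iint_ge0 => v _; exact: dir_integrand_ge0. Qed.

Lemma le_dir_int K a g h : (forall w, positive_weights K w -> 0 <= g w <= h w) ->
  (dir_int K a g <= dir_int K a h)%E.
Proof.
move=> gh; apply: le_iint => v _.
  by apply: dir_integrand_ge0 => w /gh/andP[].
by apply: le_dir_integrand => w /gh/andP[].
Qed.

Lemma dir_intZl K a g (c : R) : 0 <= c ->
  (forall w, positive_weights K w -> 0 <= g w) ->
  dir_int K a (fun w => c * g w) = (c%:E * dir_int K a g)%E.
Proof.
move=> c0 g0; rewrite !dir_intE -iintZl//; last first.
  by move=> v _; exact: dir_integrand_ge0.
apply: eq_iint => v _; rewrite /dir_integrand; case: ifP => _; last by rewrite mule0.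
by rewrite -EFinM mulrA.
Qed.

Lemma dir_int1 K b : (0 < K)%N -> (forall k, (k < K)%N -> 1 < b k) ->
  iint_measurable K.-1 (dir_integrand K b (fun=> 1)) /\
  dir_int K b (fun=> 1) = (dirichlet_const K b)%:E.
Proof.
move=> K0 b1; rewrite dir_intE dir_integrand1//.
have [||mk ->] := @iint_dirichlet_kernel R K.-1 1 b; rewrite ?prednK//.
by rewrite pospowE// powR1 mul1r.
Qed.

Lemma dir_expectE K b g : (0 < K)%N -> (forall k, (k < K)%N -> 1 < b k) ->
  dir_expect K b g = fine (dir_int K b g) / dirichlet_const K b.
Proof. by move=> K0 b1; rewrite /dir_expect (dir_int1 K0 b1).2. Qed.

Lemma dir_expect_powR K b k (x : R) : (forall j, (j < K)%N -> 1 < b j) ->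
  (k < K)%N -> 1 < b k + x ->
  dir_expect K b (fun w => w k `^ x) =
  dirichlet_const K (shift_at b k x) / dirichlet_const K b.
Proof.
move=> b1 kK bkx; have K0 : (0 < K)%N by exact: leq_ltn_trans kK.
have bx1 := shift_at_gt1 b1 bkx.
rewrite dir_expectE// -[dirichlet_const K (shift_at _ _ _)]/(fine _%:E).
rewrite -(dir_int1 K0 bx1).2; congr (fine _ / _).
by apply: eq_iint => v _; exact: dir_integrand_powR.
Qed.

Lemma dir_expect_le_lincomb K b g (I : finType) (c : I -> R) (k : I -> 'I_K)
    (x : I -> R) : (0 < K)%N ->
  (forall j, (j < K)%N -> 1 < b j) -> (forall j, 1 < b (k j) + x j) ->
  (forall j, 0 <= c j) ->
  (forall w, positive_weights K w -> 0 <= g w <= \sum_j c j * w (k j) `^ x j) ->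
  dir_expect K b g <= \sum_j c j * dir_expect K b (fun w => w (k j) `^ x j).
Proof.
move=> K0 b1 bx c0 gw.
pose Z j := dirichlet_const K (shift_at b (k j) (x j)).
have bx1 j := shift_at_gt1 b1 (bx j).
have le_int : (dir_int K b g <= (\sum_j c j * Z j)%:E)%E.
  pose G j := dir_integrand K (shift_at b (k j) (x j)) (fun=> 1).
  rewrite -sumEFin; under [leRHS]eq_bigr do rewrite EFinM -(dir_int1 K0 (bx1 _)).2.
  apply: (le_iint_lincomb (G := G)) => // [j v _|j|v _].
  - by apply: dir_integrand_ge0 => w _; exact: ler01.
  - exact: (dir_int1 K0 (bx1 j)).1.
  - rewrite dir_integrand_ge0/=; last by move=> w /gw/andP[].
    under [leRHS]eq_bigr do rewrite /G -dir_integrand_powR//.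
    by rewrite -dir_integrand_lincomb le_dir_integrand// => w /gw/andP[].
have int_ge0 : (0 <= dir_int K b g)%E by apply: dir_int_ge0 => w /gw/andP[].
have const_gt0 := dirichlet_const_gt0 b1.
under eq_bigr do rewrite dir_expect_powR// mulrA.
rewrite -mulr_suml dir_expectE// ler_wpM2r ?invr_ge0 ?(ltW const_gt0)//.
rewrite -[leRHS]/(fine _%:E) fine_le//; rewrite ge0_fin_numE//.
exact: le_lt_trans le_int (ltry _).
Qed.

Lemma dir_expect_powR_nat_le K b k m : (forall j, (j < K)%N -> 1 < b j) ->
  (k < K)%N ->
  dir_expect K b (fun w => w k `^ m%:R) <=
  ((b k + m%:R) / (\sum_(j < K) b j)) ^+ m.
Proof.
move=> b1 kK; have K0 : (0 < K)%N by exact: leq_ltn_trans kK.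
have bk1 := b1 k kK.
have S1 : 1 < \sum_(j < K) b j by case: K b1 kK K0 => // K b1 _ _; exact: sum_gt1.
rewrite dir_expect_powR ?ltr_wpDr// dirichlet_const_shiftn//.
rewrite mulfK ?gt_eqF ?dirichlet_const_gt0// -[X in _ ^+ X]card_ord -prodr_const.
apply: ler_prod => i _; have im : i%:R <= m%:R :> R by rewrite ler_nat ltnW.
have i0 := ler0n R i.
rewrite divr_ge0/=; [|lra|lra].
rewrite ler_pM ?invr_ge0 ?lef_pV2 ?posrE ?lerD2l ?lerDl//; lra.
Qed.

Lemma dir_expect_powRN_nat_le K b k m : (forall j, (j < K)%N -> 1 < b j) ->
  (k < K)%N -> 1 < b k - m%:R ->
  dir_expect K b (fun w => w k `^ (- m%:R)) <=
  ((\sum_(j < K) b j) / (b k - m%:R)) ^+ m.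
Proof.
move=> b1 kK bkm; set S := \sum_(j < K) b j.
have bS : b k <= S.
  rewrite /S (bigD1 (Ordinal kK))//= lerDl sumr_ge0// => j _.
  by apply: le_trans (ltW (b1 _ (ltn_ord j))).
have bm1 := shift_at_gt1 b1 bkm.
have constE := dirichlet_const_shiftn m bm1 kK.
rewrite -shift_atD addNr shift_at0 shift_atxx sum_shift_at// -/S in constE.
rewrite dir_expect_powR// {}constE invfM mulrCA divff ?gt_eqF ?dirichlet_const_gt0//.
rewrite mulr1 -prodfV -[X in _ ^+ X]card_ord -prodr_const.
apply: ler_prod => i _; have im : i%:R <= m%:R :> R by rewrite ler_nat ltnW.
have i0 := ler0n R i.
rewrite invf_div divr_ge0/=; [|lra|lra].
by rewrite ler_pM ?invr_ge0 ?lef_pV2 ?posrE//; lra.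
Qed.

(* Markov's inequality for [w_k ^ m] and for [w_k ^ - m]. *)
Lemma dir_expect_leaves_box K b m (lo up : nat -> R) (E : set (nat -> R)) :
  (0 < K)%N -> (forall k, (k < K)%N -> 1 < b k - m%:R) ->
  (forall k, (k < K)%N -> 0 < lo k) -> (forall k, (k < K)%N -> 0 < up k) ->
  (forall w, E w -> exists k : 'I_K, w k < lo k \/ up k < w k) ->
  dir_expect K b \1_E <=
  \sum_(k < K) (((\sum_(j < K) b j) * lo k / (b k - m%:R)) ^+ m +
                ((b k + m%:R) / ((\sum_(j < K) b j) * up k)) ^+ m).
Proof.
move=> K0 bm lo0 up0 leaves; have m0 := ler0n R m.
have b1 k : (k < K)%N -> 1 < b k by move=> kK; have := bm k kK; lra.
pose c (j : 'I_K * bool) := if j.2 then lo j.1 ^+ m else (up j.1)^-1 ^+ m.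
pose x (j : 'I_K * bool) : R := if j.2 then - m%:R else m%:R.
have lo_ge0 (k : 'I_K) : 0 <= lo k by rewrite ltW ?lo0.
have upV_ge0 (k : 'I_K) : 0 <= (up k)^-1 by rewrite invr_ge0 ltW ?up0.
have c0 j : 0 <= c j by rewrite /c; case: ifP => _; rewrite exprn_ge0.
have bx (j : 'I_K * bool) : 1 < b j.1 + x j.
  by rewrite /x; case: ifP => _; [exact: bm|have := b1 j.1 (ltn_ord _); lra].
apply: (le_trans (dir_expect_le_lincomb K0 b1 bx c0 _)) => [w w0|].
  rewrite indicE ler0n/=; set M := \sum_j _.
  have term_ge0 (j : 'I_K * bool) : 0 <= c j * w j.1 `^ x j.
    by rewrite mulr_ge0 ?powR_ge0.
  have term_le (j : 'I_K * bool) : c j * w j.1 `^ x j <= M.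
    by rewrite /M (bigD1 j)//= lerDl sumr_ge0.
  have [|_] := boolP (w \in E); last exact: sumr_ge0.
  rewrite inE => /leaves[k [wk|wk]].
  - apply: le_trans (term_le (k, true)); rewrite /c /x /=.
    rewrite powRN powR_mulrn ?(ltW (w0 _ _))// -exprVn -exprMn exprn_ege1//.
    by rewrite ler_pdivlMr ?w0// mul1r ltW.
  - apply: le_trans (term_le (k, false)); rewrite /c /x /=.
    rewrite powR_mulrn ?(ltW (w0 _ _))// -exprMn exprn_ege1//.
    by rewrite mulrC ler_pdivlMr ?up0// mul1r ltW.
rewrite -(pair_big xpredT xpredT (fun (k : 'I_K) s =>
  c (k, s) * dir_expect K b (fun w => w k `^ x (k, s))))/=.
apply: ler_sum => k _; rewrite big_bool /c /x /= lerD//.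
- rewrite mulrAC [_ * lo k]mulrC exprMn ler_wpM2l ?exprn_ge0//.
  by rewrite dir_expect_powRN_nat_le ?bm.
- rewrite invfM [in leRHS]mulrA [_ * (up k)^-1]mulrC exprMn.
  rewrite ler_wpM2l ?exprn_ge0//.
  by rewrite dir_expect_powR_nat_le.
Qed.

End dirichlet_expectation.

Section histograms.
Context {R : realType}.
Implicit Types (a w X : nat -> R) (x : R) (L k n : nat) (A : set R).

Lemma inbin_ub L k x : inbin L k x -> x <= k.+1%:R * (2 ^+ L)^-1.
Proof. by rewrite /inbin; case: eqP => [->|_] /andP[_]; rewrite ?mul1r. Qed.

Lemma inbin_lb L k x : inbin L k x -> k%:R * (2 ^+ L)^-1 <= x.
Proof.
by rewrite /inbin; case: eqP => [->|_] /andP[x0 _]; rewrite ?mul0r// ltW.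
Qed.

Lemma inbin_exists L x : I01 x -> exists k : 'I_(2 ^ L), inbin L k x.
Proof.
rewrite /I01/= in_itv/= => /andP[x0 x1].
have K0 : 0 < (2 : R) ^+ L by rewrite exprn_gt0.
have last_bin : x <= (2 ^ L).-1.+1%:R * (2 ^+ L)^-1.
  by rewrite prednK ?expn_gt0// natrX divff ?gt_eqF.
have below : exists k, x <= k.+1%:R * (2 ^+ L)^-1 by exists (2 ^ L).-1.
have kL : (ex_minn below < 2 ^ L)%N.
  case: ex_minnP => k _ kmin; rewrite -(prednK (n := 2 ^ L)) ?expn_gt0// ltnS.
  exact: kmin.
exists (Ordinal kL) => /=; case: ex_minnP => -[|k] xk kmin.
  by rewrite /inbin eqxx x0 -[X in _ <= X]mul1r.
rewrite /inbin/= xk andbT ltNge; apply/negP => /kmin.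
by rewrite ltnn.
Qed.

Lemma inbin_unique L k j x : inbin L k x -> inbin L j x = (j == k).
Proof.
have no_later i i' : inbin L i x -> (i < i')%N -> ~~ inbin L i' x.
  move=> /inbin_ub xi ii'; rewrite /inbin gtn_eqF ?(leq_ltn_trans _ ii')//.
  rewrite negb_and -leNgt; apply/orP; left; apply: le_trans xi _.
  by rewrite ler_pM2r ?invr_gt0 ?exprn_gt0// ler_nat.
move=> xk; case: (ltngtP j k) => [jk|kj|->//].
  by apply/negP => /no_later/(_ jk); rewrite xk.
exact/negbTE/(no_later _ _ xk).
Qed.

Lemma hist_inbin L (k : 'I_(2 ^ L)) w x : inbin L k x -> hist L w x = 2 ^+ L * w k.
Proof.
move=> xk; rewrite /hist (bigD1 k)//= xk mulr1 big1 ?addr0// => j /negbTE jk.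
by rewrite (inbin_unique _ xk) [_ == _]jk mulr0.
Qed.

Definition bin L k : set R := [set x | inbin L k x].

Lemma mem_bin L k x : (x \in bin L k) = inbin L k x.
Proof. by apply/idP/idP; rewrite inE. Qed.

Lemma binE L k : bin L k =
  [set` Interval (BSide (k == 0%N) (k%:R * (2 ^+ L)^-1))
                 (BRight (k.+1%:R * (2 ^+ L)^-1))].
Proof.
apply/seteqP; split=> x; rewrite /bin /inbin/= itv_boundlr /=;
  by case: eqP => [->|_]; rewrite ?mul0r ?mul1r.
Qed.

Lemma measurable_bin L k : measurable (bin L k).
Proof. by rewrite binE; exact: measurable_itv. Qed.

Lemma bin_sub_I01 L k : (k < 2 ^ L)%N -> bin L k `<=` I01.
Proof.
move=> kL x xk; rewrite /I01/= in_itv/=; apply/andP; split.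
  by apply: le_trans (inbin_lb xk); rewrite mulr_ge0 ?ler0n// invr_ge0 exprn_ge0.
apply: le_trans (inbin_ub xk) _; rewrite ler_pdivrMr ?exprn_gt0// mul1r.
by rewrite -natrX ler_nat.
Qed.

Lemma lebesgue_measure_bin L k :
  lebesgue_measure (bin L k) = ((2 ^+ L)^-1)%:E :> \bar R.
Proof.
rewrite binE lebesgue_measure_itv/= lte_fin.
have K0 : 0 < (2 ^+ L)^-1 :> R by rewrite invr_gt0 exprn_gt0.
by rewrite ltr_pM2r// ltr_nat ltnSn -EFinB -mulrBl -natrB// subSnn mul1r.
Qed.

Definition count_in A n X : nat := (\sum_(i < n) (X i \in A))%N.

Lemma prod_hist L n X w : cube n X ->
  \prod_(i < n) hist L w (X i) =
  (2 ^+ L) ^+ n * \prod_(k < 2 ^ L) w k ^+ count_in (bin L k) n X.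
Proof.
move=> XI; transitivity
  (\prod_(i < n) (2 ^+ L * \prod_(k < 2 ^ L) w k ^+ (X i \in bin L k))).
  apply: eq_bigr => i _; have [k Xk] := inbin_exists L (XI i (ltn_ord i)).
  rewrite (hist_inbin _ Xk); congr (_ * _).
  rewrite (bigD1 k)//= mem_bin Xk expr1 big1 ?mulr1// => j /negbTE jk.
  by rewrite mem_bin (inbin_unique _ Xk) [_ == _]jk.
rewrite big_split /= prodr_const card_ord; congr (_ * _).
by rewrite exchange_big/=; apply: eq_bigr => k _; rewrite prodrXr.
Qed.

Lemma sum_count_bin L n X : cube n X ->
  (\sum_(k < 2 ^ L) count_in (bin L k) n X = n)%N.
Proof.
move=> XI; rewrite /count_in exchange_big/= -[RHS]card_ord -sum1_card.
apply: eq_bigr => i _; have [k Xk] := inbin_exists L (XI i (ltn_ord i)).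
rewrite (bigD1 k)//= mem_bin Xk big1// => j /negbTE jk.
by rewrite mem_bin (inbin_unique _ Xk) [_ == _]jk.
Qed.

End histograms.

Section posterior.
Context {R : realType}.
Implicit Types (a w X : nat -> R) (L k n : nat) (B : set (R -> R)).

Definition posterior_param L a n X : nat -> R :=
  fun k => a k + (count_in (bin L k) n X)%:R.

Lemma dir_int_likelihood L a n X (g : (nat -> R) -> R) : cube n X ->
  (forall w, positive_weights (2 ^ L) w -> 0 <= g w) ->
  dir_int (2 ^ L) a (fun w => g w * \prod_(i < n) hist L w (X i)) =
  (((2 ^+ L) ^+ n)%:E * dir_int (2 ^ L) (posterior_param L a n X) g)%E.
Proof.
move=> XI g0; rewrite -dir_intZl// ?exprn_ge0//; apply: eq_iint => v _.
transitivity (dir_integrand (2 ^ L) a (fun w => (2 ^+ L) ^+ n * g w *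
    \prod_(k < 2 ^ L) w k `^ (count_in (bin L k) n X)%:R) v); last first.
  exact: (dir_integrand_prod_powR _ _ (fun k => (count_in (bin L k) n X)%:R)).
rewrite /dir_integrand; case: ifPn => // /simplex_interiorP v0; congr (_ * _)%:E.
rewrite prod_hist// -mulrA mulrCA; congr (_ * (_ * _)).
by apply: eq_bigr => k _; rewrite powR_mulrn// ltW// v0.
Qed.

Lemma fineZl (c : R) (x : \bar R) : 0 < c -> fine (c%:E * x) = c * fine x.
Proof.
move=> c0; case: x => [//| |].
- by rewrite mulry gtr0_sg// mul1e /= mulr0.
- by rewrite mulrNy gtr0_sg// mul1e /= mulr0.
Qed.

(* Only an inequality: the normalizing constant of the prior cancels unless
   [fine] sends it to 0, in which case [hist_posterior] is the junk value 0. *)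
Lemma hist_posterior_le_dir_expect L a n X B : cube n X ->
  0 <= hist_posterior L a n X B <=
  dir_expect (2 ^ L) (posterior_param L a n X) \1_(hist L @^-1` B).
Proof.
move=> XI; rewrite /hist_posterior /dir_expect.
have ind0 w : 0 <= (hist L w \in B)%:R :> R by exact: ler0n.
have one0 (w : nat -> R) : 0 <= 1 :> R by exact: ler01.
rewrite (dir_int_likelihood a XI (fun w _ => ind0 w)).
have -> : (fun w => \prod_(i < n) hist L w (X i)) =
    (fun w => 1 * \prod_(i < n) hist L w (X i)).
  by apply/funext => w; rewrite mul1r.
rewrite (dir_int_likelihood a XI (fun w _ => one0 w)).
set C : R := (2 ^+ L) ^+ n; have C0 : 0 < C by rewrite !exprn_gt0.
rewrite !fineZl//; set num := fine _; set prior := fine _; set den := fine _.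
have num0 : 0 <= num by apply: fine_ge0; apply: dir_int_ge0 => w _; exact: ind0.
have den0 : 0 <= den by apply: fine_ge0; apply: dir_int_ge0 => w _; exact: one0.
have [->|prior0] := eqVneq prior 0.
  by rewrite invr0 !mulr0 mul0r lexx/= divr_ge0.
suff -> : C * num / prior / (C * den / prior) = num / den by rewrite lexx divr_ge0.
have [->|den_neq0] := eqVneq den 0; first by rewrite mulr0 mul0r invr0 !mulr0.
by field; rewrite den_neq0 prior0 gt_eqF.
Qed.

Lemma fine_ratio_le1 (x y : \bar R) : (0 <= x)%E -> (x <= y)%E ->
  fine x / fine y <= 1.
Proof.
case: x y => [x| |] [y| |]//=; rewrite ?invr0 ?mulr0 ?mul0r// !lee_fin => x0 xy.
have [->|y0] := eqVneq y 0; first by rewrite invr0 mulr0.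
by rewrite ler_pdivrMr ?mul1r// lt_def y0 (le_trans x0).
Qed.

Lemma hist_posterior_le1 L a n X B : cube n X -> hist_posterior L a n X B <= 1.
Proof.
move=> XI; have /andP[_ /le_trans] := hist_posterior_le_dir_expect L a B XI; apply.
apply: fine_ratio_le1; first by apply: dir_int_ge0 => w _; exact: ler0n.
by apply: le_dir_int => w _; rewrite indicE ler0n lern1 leq_b1.
Qed.

End posterior.

Section exponential_bounds.
Context {R : realType}.
Implicit Types (l p : R).

Lemma expR_le_quad l : l <= 1 / 2 -> expR l - 1 - l <= 2 * l ^+ 2.
Proof.
move=> l2; have l1 : 0 < 1 - l by lra.
have expR_le : expR l * (1 - l) <= 1.
  have := expR_ge1Dx (- l); rewrite expRN.
  by rewrite mulrC -ler_pdivlMr ?expR_gt0// mul1r.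
suff : expR l <= 1 + l + 2 * l ^+ 2 by lra.
rewrite -(ler_pM2r l1); apply: le_trans expR_le _.
have l2_ge0 : 0 <= l ^+ 2 * (1 - 2 * l) by rewrite mulr_ge0 ?sqr_ge0//; lra.
have -> : (1 + l + 2 * l ^+ 2) * (1 - l) = 1 + l ^+ 2 * (1 - 2 * l) by ring.
by lra.
Qed.

Definition centered_bernoulli_mgf p l : R :=
  p * expR (l * (1 - p)) + (1 - p) * expR (- (l * p)).

Lemma centered_bernoulli_mgf_le p l : l <= 1 / 2 -> 0 <= p ->
  centered_bernoulli_mgf p l <= expR (2 * p * l ^+ 2).
Proof.
move=> l2 p0; rewrite /centered_bernoulli_mgf.
have -> : p * expR (l * (1 - p)) + (1 - p) * expR (- (l * p)) =
    expR (- (l * p)) * (1 + p * (expR l - 1)).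
  have -> : l * (1 - p) = l + - (l * p) by ring.
  by rewrite expRD; ring.
apply: (@le_trans _ _ (expR (- (l * p)) * expR (p * (expR l - 1)))).
  by rewrite ler_wpM2l ?expR_ge0 ?expR_ge1Dx.
rewrite -expRD ler_expR.
have := ler_wpM2l p0 (expR_le_quad l2).
by lra.
Qed.

Lemma expR_two_sided_ge1 (l t d : R) : 0 <= l -> t <= `|d| ->
  1 <= \sum_(s : bool) expR (- (l * t)) * expR ((-1) ^+ s * l * d).
Proof.
move=> l0 td; rewrite (bigD1 (d < 0))//= -[leLHS]addr0 lerD//; last first.
  by apply: sumr_ge0 => s _; rewrite mulr_ge0 ?expR_ge0.
rewrite -expRD -[leLHS]expR0 ler_expR mulrAC -normrEsign.
by rewrite addrC subr_ge0 [l * t]mulrC ler_wpM2r.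
Qed.

End exponential_bounds.

Section indicator_integrals.
Context {R : realType}.
Local Notation mu := (@lebesgue_measure R).
Implicit Types (A : set R).

Lemma integrable_mul_indic (g : R -> R) A : measurable A ->
  mu.-integrable I01 (EFin \o g) ->
  mu.-integrable I01 (EFin \o (fun x => g x * \1_A x)).
Proof.
move=> mA ig; have /integrableP[/measurable_EFinP mg _] := ig.
apply: le_integrable ig; first exact: measurable_I01.
  by apply: measurable_EFin; apply: measurable_funM => //; exact: measurable_indic.
move=> x xI; rewrite /= lee_fin normrM ler_piMr// indicE.
by rewrite ger0_norm ?ler0n// lern1 leq_b1.
Qed.

Lemma integrable_cst_indic (c : R) A : measurable A ->
  mu.-integrable I01 (EFin \o (fun x => c * \1_A x)).
Proof.
move=> mA; apply: (@integrable_mul_indic (cst c)) => //.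
apply: continuous_compact_integrable; first exact: segment_compact.
by apply: continuous_subspaceT => x; exact: cst_continuous.
Qed.

Lemma Rintegral_cst_indic (c : R) A : measurable A -> A `<=` I01 ->
  (\int[mu]_(x in I01) (c * \1_A x))%R = c * fine (mu A).
Proof.
move=> mA AI; have indicE1 : (fun x => 1 * \1_A x) = \1_A :> (R -> R).
  by apply/funext => x; rewrite mul1r.
rewrite RintegralZl; [|exact: measurable_I01|]; last first.
  by rewrite -indicE1; exact: integrable_cst_indic.
rewrite /Rintegral integral_indic//; last exact: measurable_I01.
by congr (_ * fine (mu _)); exact/setIidl.
Qed.

End indicator_integrals.

Section sampling.
Context {R : realType}.
Local Notation mu := (@lebesgue_measure R).
Context (f : R -> R) (df : density01 f).
Implicit Types (A : set R) (l p x : R) (n : nat) (X : nat -> R).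

Definition density_prob A : R := (\int[mu]_(x in I01) (f x * \1_A x))%R.

Lemma density_ge0 x : I01 x -> 0 <= f x.
Proof. by case: df => _ [f0 _] xI; apply: f0; rewrite inE. Qed.

Let measurable_f : measurable_fun I01 f. Proof. by case: df. Qed.

Let integral_f : (\int[mu]_(x in I01) (f x)%:E = 1)%E.
Proof. by case: df => _ []. Qed.

Let integrable_f : mu.-integrable I01 (EFin \o f).
Proof.
apply/integrableP; split; first exact: measurable_EFin measurable_f.
rewrite (_ : (\int[mu]_(x in I01) _)%E = 1%E) ?ltry// -integral_f.
by apply: eq_integral => x; rewrite inE => xI; rewrite /= ger0_norm ?density_ge0.
Qed.

Lemma density_prob_ge0 A : 0 <= density_prob A.
Proof.
by apply: Rintegral_ge0 => x xI; rewrite mulr_ge0 ?density_ge0// indicE ler0n.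
Qed.

Lemma density_prob_bounds (lo hi : R) A : measurable A -> A `<=` I01 ->
  (forall x, A x -> lo <= f x <= hi) ->
  lo * fine (mu A) <= density_prob A <= hi * fine (mu A).
Proof.
move=> mA AI fb; rewrite -!Rintegral_cst_indic// /density_prob.
have ifA := integrable_mul_indic mA integrable_f.
have indic_le (g h : R -> R) : (forall x, A x -> g x <= h x) ->
    forall x, g x * \1_A x <= h x * \1_A x.
  move=> gh x; rewrite indicE; case: (boolP (x \in A)); last by rewrite !mulr0.
  by rewrite !mulr1 inE => /gh.
by apply/andP; split; apply: le_Rintegral; rewrite ?integrable_cst_indic//;
  try exact: measurable_I01; move=> x _; apply: indic_le => {}x /fb/andP[].
Qed.

Lemma integral_density_mgf l A (p := density_prob A) : measurable A ->
  (\int[mu]_(x in I01) (f x * expR (l * (\1_A x - p)))%:E)%E =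
  (centered_bernoulli_mgf p l)%:E.
Proof.
rewrite /centered_bernoulli_mgf => mA.
set e1 := expR (l * (1 - p)); set e0 := expR (- (l * p)).
have integrable_off : mu.-integrable I01 (EFin \o (fun x => e0 * f x)).
  by apply: (@integrableZl _ _ _ mu _ _ e0 (EFin \o f)) => //; exact: measurable_I01.
have integrable_on :
    mu.-integrable I01 (EFin \o (fun x => (e1 - e0) * (f x * \1_A x))).
  apply: (@integrableZl _ _ _ mu _ _ (e1 - e0) (EFin \o (fun x => f x * \1_A x))).
    exact: measurable_I01.
  exact: integrable_mul_indic.
transitivity (\int[mu]_(x in I01) (e0 * f x + (e1 - e0) * (f x * \1_A x))%:E)%E.
  apply: eq_integral => x _; congr EFin; rewrite indicE /e1 /e0.
  by case: (x \in A) => /=; rewrite ?mulr1 ?mulr0 ?sub0r ?mulrN; ring.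
under eq_integral do rewrite EFinD.
rewrite integralD//; last exact: measurable_I01.
have Rintegral_f : (\int[mu]_(x in I01) f x)%R = 1 by rewrite /Rintegral integral_f.
have EFin_integral (g : R -> R) : mu.-integrable I01 (EFin \o g) ->
    (\int[mu]_(x in I01) (g x)%:E)%E = (\int[mu]_(x in I01) g x)%R%:E.
  move=> ig; rewrite /Rintegral fineK//; apply: integrable_fin_num => //.
  exact: measurable_I01.
rewrite !EFin_integral// -EFinD; congr EFin.
rewrite RintegralZl//; last exact: measurable_I01.
rewrite RintegralZl//; [|exact: measurable_I01|exact: integrable_mul_indic].
by rewrite Rintegral_f -/(density_prob A) -/p; ring.
Qed.

Lemma density_mgf_ge0 l A : measurable A ->
  0 <= centered_bernoulli_mgf (density_prob A) l.
Proof.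
move=> mA; rewrite -lee_fin -integral_density_mgf//; apply: integral_ge0 => x xI.
by rewrite lee_fin mulr_ge0 ?expR_ge0 ?density_ge0.
Qed.

End sampling.

Section chernoff_bound.
Context {R : realType} (f : R -> R) (df : density01 f) (n : nat).
Implicit Types (A : set R) (l t p : R) (G : (nat -> R) -> R).

Lemma expect_iid_ge0 G : (forall X, cube n X -> 0 <= G X) ->
  (0 <= expect_iid f n G)%E.
Proof.
move=> G0; apply: iint_ge0 => X XI; rewrite lee_fin mulr_ge0 ?G0//.
by apply: prodr_ge0 => i _; apply: (density_ge0 df); exact: XI.
Qed.

Lemma expect_iid_le_lincomb (I : finType) (c t : I -> R) (h : I -> R -> R) G :
  (forall j, 0 <= c j) -> (forall j, measurable_fun I01 (h j)) ->
  (forall j x, I01 x -> 0 <= h j x) ->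
  (forall j, (\int[lebesgue_measure]_(x in I01) (f x * h j x)%:E)%E = (t j)%:E) ->
  (forall X, cube n X -> 0 <= G X <= \sum_j c j * \prod_(i < n) h j (X i)) ->
  (expect_iid f n G <= (\sum_j c j * t j ^+ n)%:E)%E.
Proof.
move=> c0 mh h0 ht Gh; have f0 := density_ge0 df.
have mfh j : measurable_fun I01 (fun x => f x * h j x).
  by apply: measurable_funM => //; case: df.
have fh0 j x : I01 x -> 0 <= f x * h j x by move=> xI; rewrite mulr_ge0 ?f0 ?h0.
have prodE j := iint_prod n (mfh j) (fh0 j) (ht j).
rewrite -sumEFin; under [leRHS]eq_bigr do rewrite EFinM -(prodE _).2.
apply: le_iint_lincomb => // [j X XI|j|X XI].
- by rewrite lee_fin prodr_ge0// => i _; apply: fh0; exact: XI.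
- exact: (prodE j).1.
have F0 : 0 <= \prod_(i < n) f (X i).
  by apply: prodr_ge0 => i _; apply: f0; exact: XI.
have /andP[G0 Gle] := Gh X XI.
rewrite lee_fin mulr_ge0//=.
under [leRHS]eq_bigr do rewrite -EFinM big_split mulrCA.
by rewrite sumEFin lee_fin -mulr_sumr ler_wpM2l.
Qed.

Lemma expect_iid_le_cstD (I : finType) (delta : R) (c t : I -> R)
    (h : I -> R -> R) G : 0 <= delta ->
  (forall j, 0 <= c j) -> (forall j, measurable_fun I01 (h j)) ->
  (forall j x, I01 x -> 0 <= h j x) ->
  (forall j, (\int[lebesgue_measure]_(x in I01) (f x * h j x)%:E)%E = (t j)%:E) ->
  (forall X, cube n X -> 0 <= G X <= delta + \sum_j c j * \prod_(i < n) h j (X i)) ->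
  (expect_iid f n G <= (delta + \sum_j c j * t j ^+ n)%:E)%E.
Proof.
move=> delta0 c0 mh h0 ht Gh.
have sum_unit (g : unit + I -> R) : \sum_j g j = g (inl tt) + \sum_j g (inr j).
  by rewrite big_sumType (bigD1 tt)//= big1 ?addr0//; case.
pose c' (j : unit + I) := if j is inr i then c i else delta.
pose t' (j : unit + I) := if j is inr i then t i else 1.
pose h' (j : unit + I) (x : R) := if j is inr i then h i x else 1.
have -> : delta + \sum_j c j * t j ^+ n = \sum_j c' j * t' j ^+ n.
  by rewrite sum_unit /= expr1n mulr1.
apply: (@expect_iid_le_lincomb _ c' t' h') => [[]|[u|j]|[]|[u|j]|X XI]//=.
- exact: measurable_cst.
- exact: mh.
- by under eq_integral do rewrite mulr1; case: df => _ [].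
- by rewrite sum_unit /= big1_eq mulr1; exact: Gh.
Qed.

Lemma prod_expR_indic A l p (X : nat -> R) :
  \prod_(j < n) expR (l * (\1_A (X j) - p)) =
  expR (l * ((count_in A n X)%:R - n%:R * p)).
Proof.
rewrite -expR_sum; congr expR; rewrite -mulr_sumr sumrB sumr_const card_ord.
by rewrite mulr_natl natr_sum; congr (_ * (_ - _)).
Qed.

Lemma chernoff_term_le A (s : bool) l t (p := density_prob f A) :
  measurable A -> 0 <= l <= 1 / 2 ->
  expR (- (l * t)) * centered_bernoulli_mgf p ((-1) ^+ s * l) ^+ n <=
  expR (2 * n%:R * p * l ^+ 2 - l * t).
Proof.
move=> mA /andP[l0 l2]; rewrite [in leRHS]addrC expRD ler_wpM2l ?expR_ge0//.
have sl_le : (-1) ^+ s * l <= 1 / 2 by case: s; lra.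
apply: (@le_trans _ _ (expR (2 * p * ((-1) ^+ s * l) ^+ 2) ^+ n)).
  rewrite lerXn2r ?nnegrE ?expR_ge0 ?density_mgf_ge0//.
  by rewrite centered_bernoulli_mgf_le ?density_prob_ge0.
rewrite -expRM_natl exprMn sqrr_sign mul1r ler_expR le_eqVlt.
by apply/orP; left; apply/eqP; ring.
Qed.

Lemma expect_iid_deviation (I : finType) (A : I -> set R) (t : I -> R)
    (l delta : R) G (p := fun i => density_prob f (A i)) :
  (forall i, measurable (A i)) -> 0 <= l <= 1 / 2 -> 0 <= delta ->
  (forall X, cube n X -> 0 <= G X <= 1) ->
  (forall X, cube n X ->
    (forall i, `|(count_in (A i) n X)%:R - n%:R * p i| <= t i) -> G X <= delta) ->
  (expect_iid f n G <=
   (delta + \sum_i 2 * expR (2 * n%:R * p i * l ^+ 2 - l * t i))%:E)%E.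
Proof.
move=> mA l02 delta0 G01 Gdelta; have /andP[l0 _] := l02.
pose lam (s : bool) : R := (-1) ^+ s * l.
pose c (j : I * bool) := expR (- (l * t j.1)).
pose h (j : I * bool) (x : R) := expR (lam j.2 * (\1_(A j.1) x - p j.1)).
pose mgf (j : I * bool) := centered_bernoulli_mgf (p j.1) (lam j.2).
have mh j : measurable_fun I01 (h j).
  apply: (measurableT_comp (@measurable_expR R)); apply: measurable_funM => //.
  by apply: measurable_funB => //; exact: measurable_indic.
have hE (j : I * bool) := integral_density_mgf df (lam j.2) (mA j.1).
have sum_pair (g : I * bool -> R) : \sum_j g j = \sum_i \sum_s g (i, s).
  by rewrite (pair_big xpredT xpredT (fun i s => g (i, s))); apply: eq_bigr => -[].
apply: (le_trans (@expect_iid_le_cstD _ delta c mgf h _ delta0 _ mh _ hE _)).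
- by move=> j; exact: expR_ge0.
- by move=> j x _; exact: expR_ge0.
- move=> X XI; have /andP[-> G1] := G01 X XI; rewrite /= sum_pair.
  have term_ge0 i : 0 <= \sum_s c (i, s) * \prod_(j < n) h (i, s) (X j).
    by apply: sumr_ge0 => s _; rewrite prod_expR_indic mulr_ge0 ?expR_ge0.
  have [good|] :=
      boolP [forall i, `|(count_in (A i) n X)%:R - n%:R * p i| <= t i].
    by rewrite -[leLHS]addr0 lerD ?sumr_ge0 ?Gdelta//; exact/forallP.
  move=> /forallPn[i]; rewrite -ltNge => /ltW bad; apply: (le_trans G1).
  rewrite -[leLHS]add0r lerD// (bigD1 i)//= -[leLHS]addr0 lerD ?sumr_ge0//.
  apply: le_trans (expR_two_sided_ge1 l0 bad) _.
  by apply: ler_sum => s _; rewrite prod_expR_indic.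
rewrite lee_fin sum_pair lerD2l; apply: ler_sum => i _.
by rewrite big_bool mulr_natl mulr2n lerD ?chernoff_term_le.
Qed.

End chernoff_bound.

Section weight_ratios.
Context {R : realType}.
Variables (D e P y : R).
Hypotheses (D_gt0 : 0 < D) (e_gt0 : 0 < e) (y_gt0 : 0 < y) (P_le : P <= D).
Hypothesis e_small : 4 * e * (7 * D + 5) <= 1.
Implicit Types (A T m : R).

Let ey_gt0 : 0 < e * y. Proof. exact: mulr_gt0. Qed.

Let e_le : 4 * e <= 1.
Proof. by have eD_gt0 := mulr_gt0 e_gt0 D_gt0; move: e_small; lra. Qed.

Let kappa_gt0 : 0 < 7 * D + 5. Proof. by rewrite addr_gt0 ?mulr_gt0. Qed.

Let eyP_le : e * y * P <= e * y * D.
Proof. by rewrite ler_wpM2l// ltW. Qed.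

Let eyD_gt0 : 0 < e * y * D. Proof. exact: mulr_gt0. Qed.

Let eey_small : e * y * (4 * e * (7 * D + 5)) <= e * y.
Proof. by rewrite -[leRHS]mulr1 ler_pM2l. Qed.

Lemma upper_weight_ratio A T m : 0 < P -> 0 <= m <= e * y ->
  0 <= A <= P * y + (2 * D + 3) * (e * y) -> y <= T ->
  0 <= (A + m) / (T * (P + (7 * D + 5) * e)) <= 1 - 4 * e.
Proof.
move=> P_gt0 /andP[m_ge0 m_le] /andP[A_ge0 A_le] T_ge.
have up_gt0 : 0 < P + (7 * D + 5) * e by rewrite addr_gt0// (mulr_gt0 kappa_gt0).
have T_gt0 : 0 < T by exact: lt_le_trans T_ge.
apply/andP; split; first by rewrite divr_ge0 ?addr_ge0// mulr_ge0 ?ltW.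
rewrite ler_pdivrMr ?mulr_gt0//.
have : (1 - 4 * e) * (y * (P + (7 * D + 5) * e)) <=
    (1 - 4 * e) * (T * (P + (7 * D + 5) * e)).
  by rewrite ler_wpM2l ?subr_ge0// ler_pM2r.
by apply: le_trans; move: eyP_le eyD_gt0 eey_small; lra.
Qed.

Lemma lower_weight_ratio A T m : (7 * D + 5) * e < P -> 0 <= m <= e * y ->
  P * y - (2 * D + 2) * (e * y) <= A -> 0 <= T <= y + e * y ->
  0 <= T * (P - (7 * D + 5) * e) / (A - m) <= 1 - 4 * e.
Proof.
move=> P_gt /andP[m_ge0 m_le] A_ge /andP[T_ge0 T_le].
have Py_gt : (7 * D + 5) * (e * y) < P * y by rewrite mulrA ltr_pM2r.
have Am_ge : P * y - (2 * D + 3) * (e * y) <= A - m by lra.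
have Am_gt0 : 0 < A - m by move: eyD_gt0 ey_gt0; lra.
have lo_ge0 : 0 <= P - (7 * D + 5) * e by lra.
apply/andP; split; first by rewrite divr_ge0 ?mulr_ge0// ltW.
rewrite ler_pdivrMr//.
have e4_ge0 : 0 <= 1 - 4 * e by rewrite subr_ge0.
apply: le_trans (ler_wpM2l e4_ge0 Am_ge).
apply: (le_trans (ler_wpM2r lo_ge0 T_le)).
have corr_ge0 : 0 <= e * (e * y) * (2 * D + 3).
  by rewrite !mulr_ge0 ?(ltW e_gt0) ?(ltW y_gt0)//; move: D_gt0; lra.
have eey_ge0 : 0 <= e * (e * y) * (7 * D + 5).
  by rewrite !mulr_ge0 ?(ltW e_gt0) ?(ltW y_gt0)//; move: D_gt0; lra.
by move: eyP_le eyD_gt0; lra.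
Qed.

End weight_ratios.

Lemma expr_sub4_le_natV2 (R : realType) (e x : R) (n m : nat) : 0 < e ->
  4 * e <= 1 -> (0 < n)%N -> x / 2 <= m%:R -> ln n%:R <= e * x ->
  (1 - 4 * e) ^+ m <= (n%:R ^+ 2)^-1.
Proof.
move=> e0 e4 n0 xm nx; have n0' : 0 < n%:R :> R by rewrite ltr0n.
apply: (@le_trans _ _ (expR (- (4 * e)) ^+ m)).
  by rewrite lerXn2r ?nnegrE ?expR_ge0 ?subr_ge0// expR_ge1Dx.
rewrite -expRM_natl -[n%:R in leRHS]lnK ?posrE//.
rewrite -expRM_natl -expRN ler_expR mulrN lerN2.
have : (e * 4) * (x / 2) <= (e * 4) * m%:R by rewrite ler_pM2l// mulr_gt0.
by lra.
Qed.

Section bin_probabilities.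
Context {R : realType} (f0 : R -> R) (df0 : density01 f0).
Implicit Types (L k : nat) (t : R).

Definition bin_prob L k : R := density_prob f0 (bin L k).

Lemma bin_prob_mean (lo hi : R) L k : (k < 2 ^ L)%N ->
  (forall x, inbin L k x -> lo <= f0 x <= hi) ->
  lo <= 2 ^+ L * bin_prob L k <= hi.
Proof.
move=> kL f0b; have K0 : 0 < 2 ^+ L :> R by rewrite exprn_gt0.
have := density_prob_bounds df0 (@measurable_bin R L k) (bin_sub_I01 kL) f0b.
rewrite (lebesgue_measure_bin L k) /= -/(bin_prob L k) => /andP[lo_le hi_ge].
by rewrite mulrC -ler_pdivrMr// lo_le -ler_pdivlMr// hi_ge.
Qed.

Definition deviating_weights L t : set (nat -> R) :=
  [set w | exists k : 'I_(2 ^ L), w k < bin_prob L k - t / 2 ^+ L \/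
                                  bin_prob L k + t / 2 ^+ L < w k].

(* A sup-norm deviation is attained on one bin, where [f0] is close to the
   rescaled bin probability. *)
Lemma supnorm_deviating_weights (alpha C t d : R) L (w : nat -> R) : 0 < alpha ->
  (forall x y, x \in I01 -> y \in I01 -> `|f0 x - f0 y| <= C * `|x - y| `^ alpha) ->
  0 <= C -> C * (2 ^+ L)^-1 `^ alpha <= d ->
  ((t + d)%:E < supnorm01 (fun x => (hist L w x - f0 x)%R))%E ->
  deviating_weights L t w.
Proof.
move=> a0 hC C0 Cd /ereal_sup_gt[_ [x xI <-]]; rewrite lte_fin => dev.
have xI01 : I01 x by [].
have [k xk] := inbin_exists L xI01; exists k.
have K0 : 0 < 2 ^+ L :> R by rewrite exprn_gt0.
have /andP[lo hi] : f0 x - d <= 2 ^+ L * bin_prob L k <= f0 x + d.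
  apply: bin_prob_mean => // z zk.
  have zI : z \in I01 by rewrite inE; exact: bin_sub_I01 (ltn_ord k) _ zk.
  rewrite -ler_distl distrC; apply: (le_trans (hC _ _ _ zI)); first by rewrite inE.
  apply: le_trans Cd; rewrite ler_wpM2l// ge0_ler_powR ?nnegrE ?(ltW a0)
    ?invr_ge0 ?(ltW K0)//.
  have := inbin_lb xk; have := inbin_ub xk; have := inbin_lb zk; have := inbin_ub zk.
  rewrite -[k.+1%:R]natr1 mulrDl mul1r ler_norml => z_ub z_lb x_ub x_lb.
  by apply/andP; split; lra.
move: dev; rewrite (hist_inbin _ xk) => dev.
have KtE : 2 ^+ L * (t / 2 ^+ L) = t by rewrite mulrC divfK// gt_eqF.
have [dev_sign|dev_sign] := leP 0 (2 ^+ L * w k - f0 x).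
  right; rewrite -(ltr_pM2l K0) mulrDr KtE.
  by move: dev; rewrite ger0_norm//; lra.
left; rewrite -(ltr_pM2l K0) mulrBr KtE.
by move: dev; rewrite ltr0_norm//; lra.
Qed.

End bin_probabilities.

Lemma ln_ge1_gt0 (R : realType) (x : R) : 1 <= ln x -> 0 < x.
Proof. by apply: contraTT; rewrite -leNgt => x0; rewrite ln0// ler10. Qed.

Lemma upper_bound_gt0 (R : realType) (f : R -> R) (lo hi : R) : 0 < lo ->
  (forall x, I01 x -> lo <= f x <= hi) -> 0 < hi.
Proof.
move=> lo0 fb; have zeroI : @I01 R 0 by rewrite /I01/= in_itv/= lexx ler01.
by have /andP[lo_le /(le_trans lo_le)] := fb _ zeroI; exact: lt_le_trans.
Qed.

Section finite_sample.
Context {R : realType} (f0 : R -> R) (df0 : density01 f0).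
Variables (rho D c2 e : R) (L n : nat) (a : nat -> R) (B : set (R -> R)).
Local Notation K := (2 ^+ L : R).
Local Notation y := (n%:R / K).
(* Typical counts put the posterior parameters within [(2 D + 3) e y] of [n p_k];
   the margin [7 D + 5] also has to absorb the exponent [m] of the moments, the
   total mass of the prior parameters and the factor [1 - 4 e]. *)
Local Notation kappa := (7 * D + 5).
Local Notation p := (bin_prob f0 L).
Local Notation m := (Num.truncn (e * y)).
Hypotheses (rho_gt0 : 0 < rho) (f0_bounds : forall x, I01 x -> rho <= f0 x <= D).
Hypotheses (e_gt0 : 0 < e) (e_small : 4 * e * kappa <= 1) (e_rho : kappa * e < rho).
Hypothesis c2_le : c2 <= e * y.
Hypothesis a_bounds : forall k, (k < 2 ^ L)%N -> 0 <= a k <= c2.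
Hypotheses (ln_n_ge1 : 1 <= ln n%:R :> R) (ln_n_le : ln n%:R <= e * (e * y)).
Hypothesis B_deviates :
  forall w, B (hist L w) -> deviating_weights f0 L (kappa * e) w.

Let D_gt0 : 0 < D. Proof. exact: upper_bound_gt0 f0_bounds. Qed.

Let n_gt0 : (0 < n)%N.
Proof. by have := ln_ge1_gt0 ln_n_ge1; rewrite ltr0n. Qed.

Let K_gt0 : 0 < K. Proof. by rewrite exprn_gt0. Qed.

Let y_gt0 : 0 < y. Proof. by rewrite divr_gt0// ltr0n. Qed.

Let nE : n%:R = K * y. Proof. by rewrite mulrC divfK ?gt_eqF. Qed.

Let npE k : n%:R * p k = K * p k * y. Proof. by rewrite mulrAC -nE. Qed.

Let e_le : e <= 1 / 20.
Proof. by have eD_gt0 := mulr_gt0 e_gt0 D_gt0; move: e_small; lra. Qed.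

Let ey_gt0 : 0 < e * y. Proof. exact: mulr_gt0. Qed.

Let ey_ge2 : 2 <= e * y.
Proof.
have e_ey_le : e * (e * y) <= 1 / 20 * (e * y) by rewrite ler_pM2r.
by move: ln_n_ge1 ln_n_le e_ey_le; lra.
Qed.

Let p_bounds k : (k < 2 ^ L)%N -> rho <= K * p k <= D.
Proof.
move=> kL; apply: bin_prob_mean => // x xk; apply: f0_bounds.
exact: bin_sub_I01 xk.
Qed.

Definition typical_counts (X : nat -> R) : Prop := forall k, (k < 2 ^ L)%N ->
  `|(count_in (bin L k) n X)%:R - n%:R * p k| <= (2 * D + 2) * (e * y).

Lemma posterior_param_bounds X k : typical_counts X -> (k < 2 ^ L)%N ->
  K * p k * y - (2 * D + 2) * (e * y) <= posterior_param L a n X k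
    <= K * p k * y + (2 * D + 3) * (e * y).
Proof.
move=> typX kL; have /andP[a_ge0 a_le] := a_bounds kL.
have := typX k kL; rewrite npE ler_norml /posterior_param => /andP[lo hi].
by apply/andP; split; move: c2_le; lra.
Qed.

Lemma posterior_param_gt X k (s : R) : typical_counts X -> (k < 2 ^ L)%N ->
  s <= e * y -> 1 < posterior_param L a n X k - s.
Proof.
move=> typX kL s_le; have /andP[lo _] := posterior_param_bounds typX kL.
have /andP[P_ge _] := p_bounds kL.
have : kappa * (e * y) < K * p k * y.
  by rewrite mulrA ltr_pM2r// (lt_le_trans e_rho).
have : 0 < D * (e * y) by exact: mulr_gt0.
by move: s_le ey_ge2; lra.
Qed.

Lemma sum_posterior_param_bounds X : cube n X ->
  y <= (\sum_(k < 2 ^ L) posterior_param L a n X k) / K <= y + e * y.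
Proof.
move=> XI; rewrite big_split/= -natr_sum sum_count_bin//.
have sum_a_ge0 : 0 <= \sum_(k < 2 ^ L) a k.
  by apply: sumr_ge0 => k _; have /andP[] := a_bounds (ltn_ord k).
have sum_a_le : \sum_(k < 2 ^ L) a k <= K * c2.
  rewrite -natrX mulr_natl -[X in _ *+ X]card_ord -sumr_const.
  by apply: ler_sum => k _; have /andP[] := a_bounds (ltn_ord k).
rewrite [X in _ <= X <= _]mulrDl [X in _ <= X <= _]addrC lerDl lerD2l.
rewrite divr_ge0 ?(ltW K_gt0)//= ler_pdivrMr// (le_trans sum_a_le)// mulrC.
by rewrite ler_pM2r.
Qed.

Let m_bounds : e * y / 2 <= m%:R <= e * y.
Proof.
have /andP[-> m_gt] : m%:R <= e * y < m.+1%:R by exact: truncn_itv (ltW ey_gt0).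
by rewrite andbT; move: m_gt ey_ge2; rewrite -[m.+1%:R]natr1; lra.
Qed.

Let expr_ratio_le (r : R) : 0 <= r <= 1 - 4 * e -> r ^+ m <= (n%:R ^+ 2)^-1.
Proof.
move=> /andP[r_ge0 r_le]; have e4 : 4 * e <= 1 by move: e_le; lra.
have /andP[m_ge _] := m_bounds.
apply: le_trans (expr_sub4_le_natV2 e_gt0 e4 n_gt0 m_ge ln_n_le).
by rewrite lerXn2r ?nnegrE// (le_trans r_ge0).
Qed.

Let mulr_scaleD (S q r : R) : S * (q + r / K) = S / K * (K * q + r).
Proof. by field; rewrite gt_eqF. Qed.

Let mulr_scaleB (S q r : R) : S * (q - r / K) = S / K * (K * q - r).
Proof. by field; rewrite gt_eqF. Qed.

Lemma lower_weight_moment_le X k : cube n X -> typical_counts X -> (k < 2 ^ L)%N ->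
  ((\sum_(j < 2 ^ L) posterior_param L a n X j) * (p k - kappa * e / K) /
     (posterior_param L a n X k - m%:R)) ^+ m <= (n%:R ^+ 2)^-1.
Proof.
move=> XI typX kL; apply: expr_ratio_le; rewrite mulr_scaleB.
have /andP[A_lo _] := posterior_param_bounds typX kL.
have /andP[P_ge P_le] := p_bounds kL.
have /andP[T_ge T_le] := sum_posterior_param_bounds XI.
have /andP[_ m_le] := m_bounds.
apply: (lower_weight_ratio (e := e) (y := y) (D := D)) => //.
- exact: lt_le_trans P_ge.
- by rewrite ler0n.
- by rewrite T_le andbT (le_trans _ T_ge)// ltW.
Qed.

Lemma upper_weight_moment_le X k : cube n X -> typical_counts X -> (k < 2 ^ L)%N ->
  ((posterior_param L a n X k + m%:R) /
    ((\sum_(j < 2 ^ L) posterior_param L a n X j) * (p k + kappa * e / K))) ^+ m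
  <= (n%:R ^+ 2)^-1.
Proof.
move=> XI typX kL; apply: expr_ratio_le; rewrite mulr_scaleD.
have /andP[_ A_hi] := posterior_param_bounds typX kL.
have /andP[P_ge P_le] := p_bounds kL.
have /andP[T_ge _] := sum_posterior_param_bounds XI.
have /andP[_ m_le] := m_bounds.
apply: (upper_weight_ratio (e := e) (y := y) (D := D)) => //.
- exact: lt_le_trans P_ge.
- by rewrite ler0n.
- rewrite A_hi andbT -[posterior_param _ _ _ _ _]subr0 ltW// (lt_trans ltr01)//.
  by rewrite posterior_param_gt// ltW.
Qed.

Lemma hist_posterior_le_of_typical X : cube n X -> typical_counts X ->
  hist_posterior L a n X B <= 2 * K * (n%:R ^+ 2)^-1.
Proof.
move=> XI typX; have /andP[_ m_le] := m_bounds.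
have kappa_e_gt0 : 0 < kappa * e by rewrite mulr_gt0// addr_gt0 ?mulr_gt0.
have lo_gt0 k : (k < 2 ^ L)%N -> 0 < p k - kappa * e / K.
  move=> kL; rewrite subr_gt0 ltr_pdivrMr// [p k * K]mulrC.
  by have /andP[+ _] := p_bounds kL; exact: lt_le_trans.
have up_gt0 k : (k < 2 ^ L)%N -> 0 < p k + kappa * e / K.
  by move=> _; rewrite ltr_wpDl ?density_prob_ge0// divr_gt0.
have A_gt k : (k < 2 ^ L)%N -> 1 < posterior_param L a n X k - m%:R.
  by move=> kL; exact: posterior_param_gt.
have K_nat_gt0 : (0 < 2 ^ L)%N by rewrite expn_gt0.
have /andP[_ post_le] := hist_posterior_le_dir_expect L a B XI.
apply: (le_trans post_le).
apply: (le_trans (dir_expect_leaves_box K_nat_gt0 A_gt lo_gt0 up_gt0 B_deviates)).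
have -> : 2 * K * (n%:R ^+ 2)^-1 =
    \sum_(k < 2 ^ L) ((n%:R ^+ 2)^-1 + (n%:R ^+ 2)^-1).
  by rewrite sumr_const card_ord -[_ *+ (2 ^ L)]mulr_natl natrX; ring.
apply: ler_sum => k _.
by rewrite lerD ?lower_weight_moment_le ?upper_weight_moment_le.
Qed.

Lemma expect_posterior_le :
  (0 <= expect_iid f0 n (fun X => hist_posterior L a n X B) <=
   (4 * K * (n%:R ^+ 2)^-1)%:E)%E.
Proof.
have posterior_ge0 X : cube n X -> 0 <= hist_posterior L a n X B.
  by move=> /(hist_posterior_le_dir_expect L a B)/andP[].
rewrite expect_iid_ge0//=.
have e_range : 0 <= e <= 1 / 2 by rewrite ltW//=; move: e_le; lra.
apply: (le_trans (@expect_iid_deviation _ _ df0 n 'I_(2 ^ L) (fun k => bin L k)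
  (fun=> (2 * D + 2) * (e * y)) e (2 * K * (n%:R ^+ 2)^-1) _ _ e_range _ _ _)).
- by move=> k; exact: measurable_bin.
- by rewrite !mulr_ge0 ?invr_ge0 ?exprn_ge0.
- by move=> X XI; rewrite posterior_ge0 ?hist_posterior_le1.
- move=> X XI typX; apply: hist_posterior_le_of_typical => // k kL.
  exact: (typX (Ordinal kL)).
have -> : 4 * K * (n%:R ^+ 2)^-1 = 2 * K * (n%:R ^+ 2)^-1 +
    \sum_(k < 2 ^ L) 2 * (n%:R ^+ 2)^-1.
  by rewrite sumr_const card_ord -[_ *+ (2 ^ L)]mulr_natl natrX; ring.
rewrite lee_fin lerD2l; apply: ler_sum => k _; rewrite ler_pM2l//.
rewrite -[n%:R in leRHS]lnK ?posrE ?ltr0n// -expRM_natl -expRN ler_expR.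
have /andP[_ P_le] := p_bounds (ltn_ord k).
have : e * (e * y) * (K * p k) <= e * (e * y) * D.
  by rewrite ler_wpM2l// mulr_ge0 ?ltW.
rewrite -[density_prob _ _]/(p k) -[2 * n%:R * p k]mulrA npE.
by move: ln_n_le; lra.
Qed.

End finite_sample.

Section rates.
Context {R : realType}.
Implicit Types (alpha c d : R) (n : nat).

Lemma pow2_Ln_bounds alpha n : 0 < hn alpha n <= 1 ->
  2 ^+ Ln alpha n <= (hn alpha n)^-1 <= 2 * 2 ^+ Ln alpha n.
Proof.
move=> /andP[h0 h1]; have hV1 : 1 <= (hn alpha n)^-1 by rewrite invf_ge1.
have ln2_gt0 : 0 < ln 2 :> R by rewrite ln_gt0// ltr1n.
have /andP[L_le L_gt] : (Ln alpha n)%:R <= ln (hn alpha n)^-1 / ln 2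
    < (Ln alpha n).+1%:R.
  by apply: truncn_itv; rewrite divr_ge0// ln_ge0// ler1n.
have pow2E m : 2 ^+ m = expR (m%:R * ln 2) :> R by rewrite expRM_natl lnK// posrE.
have hVE : (hn alpha n)^-1 = expR (ln (hn alpha n)^-1).
  by rewrite lnK// posrE invr_gt0.
by rewrite -exprS hVE !pow2E !ler_expR -ler_pdivlMr// L_le -ler_pdivrMr// ltW.
Qed.

Lemma hn_gt0 alpha n : 1 <= ln n%:R :> R -> 0 < hn alpha n.
Proof.
move=> ln1; have n0 := ln_ge1_gt0 ln1.
by rewrite powR_gt0// divr_gt0// (lt_le_trans _ ln1).
Qed.

Lemma hn_le1 alpha n : 0 < alpha -> 1 <= ln n%:R :> R -> hn alpha n <= 1.
Proof.
move=> a0 ln1; have ln_gt0 : 0 < ln n%:R :> R by exact: lt_le_trans ln1.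
have n0 := ln_ge1_gt0 ln1.
have beta_gt0 : 0 < 1 / (2 * alpha + 1) by rewrite divr_gt0//; lra.
rewrite /hn powRN invf_le1 ?powR_gt0 ?divr_gt0// -[leLHS](powRr0 (n%:R / ln n%:R)).
rewrite ler_powR ?(ltW beta_gt0)// ler_pdivlMr// mul1r.
by rewrite ltW// ln_sublinear.
Qed.

Lemma epsn_hn alpha n : 0 < alpha -> 1 <= ln n%:R :> R ->
  epsn alpha n = hn alpha n `^ alpha.
Proof.
move=> a0 ln1; have d0 : 2 * alpha + 1 != 0 by rewrite gt_eqF//; lra.
have u0 : 0 <= n%:R / ln n%:R :> R by rewrite divr_ge0// (le_trans _ ln1).
rewrite /epsn /hn -powRrM -[ln _ / _]invf_div -(powR_inv1 u0) -powRrM.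
by congr powR; field.
Qed.

Lemma epsn_sqr alpha n : 0 < alpha -> 1 <= ln n%:R :> R ->
  epsn alpha n * (epsn alpha n * (n%:R * hn alpha n)) = ln n%:R.
Proof.
move=> a0 ln1; have h0 := hn_gt0 alpha ln1; have n0 := ln_ge1_gt0 ln1.
have d0 : 2 * alpha + 1 != 0 by rewrite gt_eqF//; lra.
have u0 : 0 <= n%:R / ln n%:R :> R by rewrite divr_ge0// (le_trans _ ln1).
have powD : hn alpha n `^ alpha * hn alpha n `^ alpha * hn alpha n =
    (n%:R / ln n%:R)^-1.
  rewrite -[X in _ * X]powRr1 ?(ltW h0)// -!powRD ?(gt_eqF h0) ?implybT//.
  by rewrite /hn -powRrM -(powR_inv1 u0); congr powR; field.
rewrite epsn_hn// mulrCA !mulrA -[_ * n%:R]mulrC -!mulrA [X in _ * X]mulrA powD.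
by rewrite invf_div mulrC divfK// gt_eqF.
Qed.

Lemma ln_le_epsn_sqr alpha n : 0 < alpha -> 1 <= ln n%:R :> R ->
  ln n%:R <= epsn alpha n * (epsn alpha n * (n%:R / 2 ^+ Ln alpha n)).
Proof.
move=> a0 ln1; have h0 := hn_gt0 alpha ln1.
have /pow2_Ln_bounds/andP[K_le _] : 0 < hn alpha n <= 1 by rewrite h0 hn_le1.
rewrite -[leLHS](epsn_sqr a0 ln1) !ler_wpM2l ?powR_ge0 ?ler0n//.
by rewrite -[leLHS]invrK lef_pV2 ?posrE ?invr_gt0 ?exprn_gt0.
Qed.

Lemma bias_le_epsn alpha n : 0 < alpha <= 1 -> 1 <= ln n%:R :> R ->
  (2 ^+ Ln alpha n)^-1 `^ alpha <= 2 * epsn alpha n.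
Proof.
move=> /andP[a0 a1] ln1; have h0 := hn_gt0 alpha ln1.
have /pow2_Ln_bounds/andP[_ K_ge] : 0 < hn alpha n <= 1 by rewrite h0 hn_le1.
have K0 : 0 < 2 ^+ Ln alpha n :> R by rewrite exprn_gt0.
have KV_le : (2 ^+ Ln alpha n)^-1 <= 2 * hn alpha n.
  rewrite -[leRHS]invrK lef_pV2 ?posrE ?invr_gt0 ?mulr_gt0// invfM mulrC.
  by rewrite ler_pdivrMr// mulrC.
apply: (@le_trans _ _ ((2 * hn alpha n) `^ alpha)).
  by rewrite ge0_ler_powR ?nnegrE ?(ltW a0) ?invr_ge0 ?(ltW K0) ?mulr_ge0 ?(ltW h0).
rewrite powRM ?(ltW h0)// -(epsn_hn a0 ln1) ler_wpM2r ?powR_ge0//.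
by rewrite ler1_powR// ler1n.
Qed.

Lemma near_ln_ge1 : \forall n \near \oo, 1 <= ln n%:R :> R.
Proof.
near=> n; have : expR 1 <= n%:R :> R by near: n; exact: nbhs_infty_ger.
move=> en; rewrite -[leLHS]expRK ler_ln ?posrE ?expR_gt0//.
exact: lt_le_trans (expR_gt0 _) en.
Unshelve. all: by end_near. Qed.

Lemma ln_le_2sqrt (x : R) : 0 < x -> ln x <= 2 * Num.sqrt x.
Proof.
move=> x0; have s0 : 0 < Num.sqrt x by rewrite sqrtr_gt0.
rewrite -[x in leLHS]sqr_sqrtr ?(ltW x0)// lnXn// -[leLHS]mulr_natl ler_pM2l//.
by rewrite ltW// ln_sublinear.
Qed.

Lemma cvg_ln_div_id : ln n%:R / n%:R @[n --> \oo] --> (0 : R).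
Proof.
apply/cvgrPdist_le => e e0; near=> n; rewrite sub0r normrN.
have n_ge1 : 1 <= n%:R :> R by near: n; exact: nbhs_infty_ger.
have n0 : 0 < n%:R :> R by exact: lt_le_trans n_ge1.
have n_ge : (2 / e) ^+ 2 <= n%:R by near: n; exact: nbhs_infty_ger.
have sqrt_ge : 2 / e <= Num.sqrt n%:R.
  by rewrite (le_trans (ler_norm _))// -sqrtr_sqr ler_wsqrtr.
rewrite ger0_norm ?divr_ge0 ?ln_ge0 ?ler0n// ler_pdivrMr//.
apply: (le_trans (ln_le_2sqrt n0)); rewrite -[n%:R in leRHS]sqr_sqrtr ?ler0n//.
by rewrite expr2 mulrA ler_wpM2r ?sqrtr_ge0// mulrC -ler_pdivrMr.
Unshelve. all: by end_near. Qed.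

Lemma cvg_epsn alpha : 0 < alpha -> epsn alpha n @[n --> \oo] --> (0 : R).
Proof.
move=> a0; have g0 : 0 < alpha / (2 * alpha + 1) by rewrite divr_gt0//; lra.
have epsnE : epsn alpha =
    pospow (alpha / (2 * alpha + 1)) \o (fun n => ln n%:R / n%:R).
  apply/funext => -[|n]; rewrite /epsn /= pospowE//.
    by rewrite invr0 mulr0.
  by rewrite divr_ge0 ?ln_ge0 ?ler1n.
rewrite epsnE -(pospow_eq0 g0 (lexx 0)).
by apply: continuous_cvg; [exact: continuous_pospow|exact: cvg_ln_div_id].
Qed.

Lemma near_epsn_lt alpha c d : 0 < alpha -> 0 < d ->
  \forall n \near \oo, c * epsn alpha n < d.
Proof.
move=> a0 d0; have : c * epsn alpha n @[n --> \oo] --> c * 0.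
  by apply: cvgM; [exact: cvg_cst|exact: cvg_epsn].
by rewrite mulr0 => /cvgr_lt; apply.
Qed.

Lemma cvg_div_nat c : (c / n%:R)%:E @[n --> \oo] --> 0%E.
Proof.
apply: cvg_EFin; first by near=> n.
rewrite (_ : 0 = c * 0); last by rewrite mulr0.
apply: cvgM; first exact: cvg_cst.
apply/(gtr0_cvgV0 (f := fun n => n%:R)); last exact: cvgr_idn.
by near=> n; rewrite ltr0n; near: n; exists 1%N.
Unshelve. all: by end_near. Qed.

End rates.

Lemma expect_supnorm_posterior_le (R : realType) (alpha C rho D c2 M : R)
    (f0 : R -> R) (a : nat -> R) (n : nat)
    (eps := epsn alpha n) (kappa := 7 * D + 5) :
  0 < alpha <= 1 -> density01 f0 ->
  0 < rho -> (forall x, I01 x -> rho <= f0 x <= D) ->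
  0 <= C ->
  (forall x y, x \in I01 -> y \in I01 -> `|f0 x - f0 y| <= C * `|x - y| `^ alpha) ->
  (forall k, (k < 2 ^ Ln alpha n)%N -> 0 <= a k <= c2) ->
  1 <= ln n%:R :> R -> 4 * kappa * eps <= 1 -> kappa * eps < rho -> c2 * eps <= 1 ->
  kappa + 2 * C <= M ->
  (0 <= expect_iid f0 n (fun X => hist_posterior (Ln alpha n) a n X
          [set f : R -> R | ((M * eps)%:E < supnorm01 (fun x => (f x - f0 x)%R))%E])
     <= (4 / n%:R)%:E)%E.
Proof.
move=> alpha01 df0 rho0 f0_bounds C0 hC a_bounds ln1 e_kappa e_rho e_c2 M_ge.
set L := Ln alpha n; set K : R := 2 ^+ L; have /andP[alpha0 _] := alpha01.
have n0 := ln_ge1_gt0 ln1.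
have ln_le : ln n%:R <= eps * (eps * (n%:R / K)) by exact: ln_le_epsn_sqr.
have eps0 : 0 < eps by rewrite powR_gt0// divr_gt0// (lt_le_trans ltr01).
have e_small : 4 * eps * kappa <= 1 by rewrite mulrAC.
have c2_le : c2 <= eps * (n%:R / K).
  by rewrite -(ler_pM2l eps0) mulrC (le_trans e_c2)// (le_trans ln1).
have D0 := upper_bound_gt0 rho0 f0_bounds.
have K_le : K <= n%:R.
  have eD0 := mulr_gt0 eps0 D0.
  have eps_sq_le1 : eps * eps <= 1.
    by rewrite mulr_ile1 ?(ltW eps0)//; move: e_small; rewrite /kappa; lra.
  rewrite -[leLHS]mul1r -ler_pdivlMr ?exprn_gt0// (le_trans ln1)//.
  by rewrite (le_trans ln_le)// mulrA ler_piMl// divr_ge0 ?exprn_ge0.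
set B := [set f | _].
have B_deviates w : B (hist L w) -> deviating_weights f0 L (kappa * eps) w.
  move=> dev.
  apply: (supnorm_deviating_weights (d := 2 * C * eps) df0 alpha0 hC C0).
    by rewrite [2 * C]mulrC -mulrA ler_wpM2l// bias_le_epsn.
  by apply: le_lt_trans dev; rewrite lee_fin -mulrDl ler_pM2r.
have /andP[-> /= le_K] := expect_posterior_le df0 rho0 f0_bounds eps0 e_small e_rho
  c2_le a_bounds ln1 ln_le B_deviates.
apply: (le_trans le_K); rewrite lee_fin ler_pdivrMr ?exprn_gt0//.
by rewrite expr2 mulrA divfK ?gt_eqF// ler_pM2l.
Qed.

Theorem theorem3 (R : realType) (alpha rho0 D0 : R) (f0 : R -> R)
  (apar : nat -> nat -> R) (a c1 c2 : R) :
  1 / 2 < alpha -> alpha <= 1 ->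
  density01 f0 ->
  0 < rho0 -> (forall x : R, x \in I01 -> rho0 <= f0 x /\ f0 x <= D0) ->
  holder alpha f0 ->
  0 < a -> 0 < c1 -> 0 < c2 ->
  (forall n k, (k < 2 ^ Ln alpha n)%N ->
     c1 * 2 `^ (- ((Ln alpha n)%:R * a)) <= apar n k /\ apar n k <= c2) ->
  forall M : nat -> R, M @ \oo --> +oo ->
  (fun n => expect_iid f0 n (fun X =>
     hist_posterior (Ln alpha n) (apar n) n X
       [set f : R -> R | (supnorm01 (fun x => (f x - f0 x)%R) >
                 (M n * epsn alpha n)%:E)%E]))
    @ \oo --> 0%E.
Proof.
move=> alpha_gt alpha1 df0 rho_gt0 f0b [C hC] _ c1_gt0 c2_gt0 hapar M Moo.
have alpha0 : 0 < alpha by apply: lt_trans alpha_gt; rewrite divr_gt0.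
have f0_bounds x : I01 x -> rho0 <= f0 x <= D0.
  by move=> xI; apply/andP; apply: f0b; rewrite inE.
have hCnorm x y : x \in I01 -> y \in I01 ->
    `|f0 x - f0 y| <= `|C| * `|x - y| `^ alpha.
  move=> xI yI; rewrite (le_trans (hC x y xI yI))//.
  by rewrite ler_wpM2r ?powR_ge0 ?ler_norm.
have apar_bounds n k : (k < 2 ^ Ln alpha n)%N -> 0 <= apar n k <= c2.
  move=> /hapar[lo ->]; rewrite andbT (le_trans _ lo)//.
  by rewrite mulr_ge0 ?(ltW c1_gt0) ?powR_ge0.
apply: (squeeze_cvge _ (cvg_cst 0%E) (cvg_div_nat 4)).
near=> n.
apply: (@expect_supnorm_posterior_le R alpha `|C| rho0 D0 c2) => //.
- by rewrite alpha0.
- exact: apar_bounds.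
- by near: n; exact: near_ln_ge1.
- by apply: ltW; near: n; exact: near_epsn_lt.
- by near: n; exact: near_epsn_lt.
- by apply: ltW; near: n; exact: near_epsn_lt.
- by near: n; move/cvgryPge : Moo; exact.
Unshelve. all: by end_near. Qed.
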